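(* Let $c,D,r,\eta_\infty>0$, and let $u(\eta,\theta,\varphi)$, $\eta\in[0,\eta_\infty)$, be the solution of the random initial value problem described in the context, whose initial field $T$ is a centered isotropic Gaussian random field on $\mathbb{S}^2$ with angular power spectrum $\{C_l\}$. If $$\sum_{l=1}^\infty C_l\,l^3<+\infty,$$ then there is a constant $C$, not depending on $\eta$, such that for each $\eta\in[0,\eta_\infty)$ and $h\in(0,\eta_\infty-\eta)$ $$\|u(\eta+h,\theta,\varphi)-u(\eta,\theta,\varphi)\|_{L^2(\Omega\times\mathbb{S}^2)}\le Ch.$$
   Context: The initial value problem is: with $e(\eta)=\frac{\eta_\infty}{\eta_\infty-\eta}$, $$\left(\frac{e(\eta)}{D}+\frac{e'(\eta)}{c^2e(\eta)}\right)\frac{\partial u}{\partial\eta}+\frac1{c^2}\frac{\partial^2u}{\partial\eta^2}-\frac1{r^2}\frac{\partial^2u}{\partial\theta^2}-\frac1{r^2\sin^2\theta}\frac{\partial^2u}{\partial\varphi^2}-\frac{\cot\theta}{r^2}\frac{\partial u}{\partial\theta}=0,$$ $u|_{\eta=0}=T(\theta,\varphi)=\sum_{l=0}^\infty\sum_{m=-l}^la_{lm}Y_{lm}(\theta,\varphi)$, $\frac{\partial u}{\partial\eta}|_{\eta=0}=0$. Its solution is the series $u(\eta,\theta,\varphi)=\sum_{l=0}^\infty F_l(\eta)\sum_{m=-l}^la_{lm}Y_{lm}(\theta,\varphi)$, convergent in $L^2(\Omega\times\mathbb{S}^2)$. Functions $F_l$: $F_0(\eta)=1$ and, for $l\in\mathbb{N}$,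 $F_l(\eta)=(\eta_\infty-\eta)^\nu\big(K_1^{(l)}J_\nu(z_l(\eta_\infty-\eta))+K_2^{(l)}Y_\nu(z_l(\eta_\infty-\eta))\big)$, with $K_1^{(l)}=\frac{\pi z_lY_{\nu-1}(z_l\eta_\infty)}{2\eta_\infty^{\nu-1}}$, $K_2^{(l)}=-\frac{\pi z_lJ_{\nu-1}(z_l\eta_\infty)}{2\eta_\infty^{\nu-1}}$, $z_l=\frac{c\sqrt{l(l+1)}}{r}$, $\nu=\frac{c^2\eta_\infty}{2D}+1$; $J_\nu,Y_\nu$ (one index) are the Bessel functions of the first and second kind. $Y_{lm}$ (two indices) are the orthonormal spherical harmonics on the unit sphere $\mathbb{S}^2$ (with measure $\sin\theta\,d\theta\,d\varphi$). $T$ is real-valued, centered, Gaussian and isotropic (finite-dimensional distributions invariant under rotations); $a_{lm}$ are (complex) Gaussian variables with $a_{lm}=(-1)^ma_{l(-m)}^*$, $Ea_{lm}=0$, $Ea_{lm}a_{l'm'}^*=\delta_m^{m'}\delta_l^{l'}C_l$; $\{C_l\}$ is the angular power spectrum. Standing assumptions: $\sum_{l\ge0}C_l(2l+1)<\infty$; and $T$ is a.s. twice continuously differentiable in $(\theta,\varphi)$, or $\sum_{l\ge1}C_l\,l^{10}(2l+1)<\infty$. Norm: $\|X\|_{L^2(\Omega\times\mathbb{S}^2)}^2=E\int_0^\pi\int_0^{2\pi}X^2(\theta,\varphi)\sin\theta\,d\varphi\,d\theta$. *)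

(* Defs.v *)
From HB Require Import structures.
From mathcomp Require Import all_boot all_order all_algebra.
From mathcomp Require Import all_classical all_reals all_analysis.
From mathcomp Require Import complex.

Set Implicit Arguments.
Unset Strict Implicit.
Unset Printing Implicit Defensive.

Import Order.TTheory GRing.Theory Num.Theory.
Import numFieldNormedType.Exports.

Local Open Scope classical_set_scope.
Local Open Scope ring_scope.

Section special_functions.
Context {R : realType}.
Implicit Types (s x t f mu nu : R) (l k : nat) (m : int).

(* 1 / Gamma(s) by Gauss' product formula: an entire function of s, equal to 0
   at s = 0, -1, -2, ... *)
Definition rgamma s : R :=
  limn (fun n => (\prod_(k < n.+1) (s + k%:R)) / (n`!%:R * n%:R `^ s)).

(* Bessel functions of real order at x > 0. *)
Definition besselJ nu x : R :=
  limn (series (fun k =>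
    (-1) ^+ k / k`!%:R * rgamma (k%:R + nu + 1) * (x / 2) `^ (k.*2%:R + nu))).

Definition besselY_quotient x nu : R :=
  (besselJ nu x * cos (nu * pi) - besselJ (- nu) x) / sin (nu * pi).

(* The order nu is an integer iff sin (nu * pi) = 0. *)
Definition besselY nu x : R :=
  if sin (nu * pi) == 0 then lim (besselY_quotient x mu @[mu --> nu^'])
  else besselY_quotient x nu.

(* Rodrigues' formula, with the Condon-Shortley phase. *)
Definition assoc_legendre l (k : nat) x : R :=
  (-1) ^+ k / (2 ^+ l * l`!%:R) * Num.sqrt (1 - x ^+ 2) ^+ k *
  (derivn (l + k) (('X ^+ 2 - 1) ^+ l)).[x].

Definition sph_harm_nneg l (k : nat) t f : R[i] :=
  (Num.sqrt ((l.*2.+1)%:R / (4 * pi) * ((l - k)`!%:R / (l + k)`!%:R)) *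
   assoc_legendre l k (cos t))%:C%C *
  (cos (k%:R * f) +i* sin (k%:R * f))%C.

(* Y_{l m}(t, f) with colatitude t and longitude f; meaningful for |m| <= l. *)
Definition sph_harm l m t f : R[i] :=
  match m with
  | Posz k => sph_harm_nneg l k t f
  | Negz k => (-1) ^+ k.+1 * (sph_harm_nneg l k.+1 t f)^*%C
  end.

End special_functions.

Section mode_functions.
Context {R : realType}.
Variables c D r eta_inf : R.

Definition nu_order : R := c ^+ 2 * eta_inf / (2 * D) + 1.

Definition z_freq (l : nat) : R := c * Num.sqrt (l * l.+1)%:R / r.

Definition K1 (l : nat) : R :=
  pi * z_freq l * besselY (nu_order - 1) (z_freq l * eta_inf) /
  (2 * eta_inf `^ (nu_order - 1)).

Definition K2 (l : nat) : R :=
  - (pi * z_freq l * besselJ (nu_order - 1) (z_freq l * eta_inf) /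
     (2 * eta_inf `^ (nu_order - 1))).

Definition F_mode (l : nat) (eta : R) : R :=
  if l == 0%N then 1
  else (eta_inf - eta) `^ nu_order *
       (K1 l * besselJ nu_order (z_freq l * (eta_inf - eta)) +
        K2 l * besselY nu_order (z_freq l * (eta_inf - eta))).

End mode_functions.

Section sphere.
Context {R : realType}.

Definition sphere2 : set 'rV[R]_3 := [set x | \sum_(i < 3) x 0 i ^+ 2 = 1].

(* spherical coordinates: colatitude t, longitude f *)
Definition sph_point (t f : R) : 'rV[R]_3 :=
  \row_(i < 3) [:: sin t * cos f; sin t * sin f; cos t]`_i.

Definition rotation3 : set 'M[R]_3 := [set M | M *m M^T = 1%:M /\ \det M = 1].

Definition C1_plane (g : R -> R -> R) : Prop :=
  [/\ forall t f, derivable (fun s => g s f) t 1,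
      forall t f, derivable (g t) f 1,
      continuous (fun p : R * R => derive1 (fun s => g s p.2) p.1) &
      continuous (fun p : R * R => derive1 (g p.1) p.2)].

Definition C2_plane (g : R -> R -> R) : Prop :=
  [/\ C1_plane g, C1_plane (fun t f => derive1 (fun s => g s f) t) &
      C1_plane (fun t f => derive1 (g t) f)].

End sphere.

Section random_fields.
Context {R : realType} {d : measure_display} {W : measurableType d}.
Variable P : probability W R.

(* The degenerate normal law is the Dirac mass; normal_prob m 0 is not. *)
Definition gaussian_rv (X : W -> R) : Prop :=
  measurable_fun setT X /\
  exists m s : R, forall A : set R, measurable A ->
    P (X @^-1` A) = if s == 0 then \d_m A else normal_prob m s A.

(* joint normality of (Re Z, Im Z) *)
Definition complex_gaussian_rv (Z : W -> R[i]) : Prop :=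
  forall x y : R,
    gaussian_rv (fun w => x * complex.Re (Z w) + y * complex.Im (Z w)).

(* E Z = v *)
Definition complex_expectation (Z : W -> R[i]) (v : R[i]) : Prop :=
  'E_P[fun w => complex.Re (Z w)]%E = (complex.Re v)%:E /\
  'E_P[fun w => complex.Im (Z w)]%E = (complex.Im v)%:E.

Definition gaussian_field (T : 'rV[R]_3 -> W -> R) : Prop :=
  forall (n : nat) (x : 'I_n -> 'rV[R]_3) (b : 'I_n -> R),
    (forall i, sphere2 (x i)) ->
    gaussian_rv (fun w => \sum_(i < n) b i * T (x i) w).

Definition centered_field (T : 'rV[R]_3 -> W -> R) : Prop :=
  forall x, sphere2 x -> 'E_P[T x]%E = 0%E.

Definition isotropic_field (T : 'rV[R]_3 -> W -> R) : Prop :=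
  forall (n : nat) (x : 'I_n -> 'rV[R]_3) (M : 'M[R]_3)
         (A : set (n.-tuple R)),
    (forall i, sphere2 (x i)) -> rotation3 M -> measurable A ->
    P ((fun w => [tuple T (x i *m M) w | i < n]) @^-1` A) =
    P ((fun w => [tuple T (x i) w | i < n]) @^-1` A).

(* Random fields in spherical coordinates are maps R -> R -> W -> R
   (colatitude, longitude, sample point). *)
Definition jointly_measurable (X : R -> R -> W -> R) : Prop :=
  measurable_fun
    ([set: W] `*` (`[0, pi] `*` `[0, 2 * pi]) : set (W * (R * R)))
    (fun p => X p.2.1 p.2.2 p.1).

Definition L2norm (X : R -> R -> W -> R) : \bar R :=
  poweR
    (\int[P]_w \int[lebesgue_measure]_(t in `[0%R, pi%R])
       \int[lebesgue_measure]_(f in `[0%R, (2 * pi)%R])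
         ((X t f w ^+ 2 * sin t)%R)%:E)%E
    2^-1.

(* sum_(l < n) G l * sum_(-l <= m <= l) a_{l m} Y_{l m} *)
Definition harmonic_sum (G : nat -> R) (a : nat -> int -> W -> R[i]) (n : nat)
    (t f : R) (w : W) : R[i] :=
  \sum_(l < n) (G l)%:C%C *
    \sum_(i < l.*2.+1)
      let m := (i%:Z - l%:Z)%R in a l m w * sph_harm l m t f.

(* X = sum_l G l * sum_m a_{l m} Y_{l m}, convergent in L^2(Omega x S^2) *)
Definition L2_expansion (G : nat -> R) (a : nat -> int -> W -> R[i])
    (X : R -> R -> W -> R) : Prop :=
  jointly_measurable X /\
  L2norm (fun t f w =>
    complex.ComplexField.Normc.normc ((X t f w)%:C%C - harmonic_sum G a n t f w))
    @[n --> \oo] --> 0%E.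

Definition harmonic_coefficients (a : nat -> int -> W -> R[i]) (C : nat -> R) :
    Prop :=
  [/\ forall l m, (`|m| <= l)%N -> complex_gaussian_rv (a l m),
      forall l m w, (`|m| <= l)%N ->
        a l m w = (-1) ^+ `|m|%N * (a l (- m) w)^*%C,
      forall l m, (`|m| <= l)%N -> complex_expectation (a l m) 0 &
      forall l m l' m', (`|m| <= l)%N -> (`|m'| <= l')%N ->
        complex_expectation (fun w => a l m w * (a l' m' w)^*%C)
          (if (l == l') && (m == m') then (C l)%:C%C else 0)].

Definition in_coordinates (T : 'rV[R]_3 -> W -> R) : R -> R -> W -> R :=
  fun t f => T (sph_point t f).

(* T is a centered isotropic Gaussian field on the sphere, with harmonic
   coefficients a and angular power spectrum C. *)
Definition initial_field (T : 'rV[R]_3 -> W -> R)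
    (a : nat -> int -> W -> R[i]) (C : nat -> R) : Prop :=
  [/\ gaussian_field T, centered_field T, isotropic_field T,
      harmonic_coefficients a C &
      L2_expansion (fun=> 1) a (in_coordinates T)].

Definition standing_assumptions (T : 'rV[R]_3 -> W -> R) (C : nat -> R) : Prop :=
  (\sum_(0 <= l <oo) (C l * (l.*2.+1)%:R)%:E < +oo)%E /\
  ({ae P, forall w, C2_plane (fun t f => in_coordinates T t f w)} \/
   (\sum_(1 <= l <oo) (C l * l%:R ^+ 10 * (l.*2.+1)%:R)%:E < +oo)%E).

(* The solution, for 0 <= eta < eta_inf, of
     (e / D + e' / (c^2 e)) u_eta + u_{eta eta} / c^2 - (Laplace-Beltrami u) / r^2 = 0,
     e(eta) = eta_inf / (eta_inf - eta),  u(0) = sum a_{l m} Y_{l m},  u_eta(0) = 0,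
   is the L^2 expansion with the modes F_l, where F_l solves
     (e / D + e' / (c^2 e)) F_l' + F_l'' / c^2 + l (l + 1) / r^2 F_l = 0,
     F_l(0) = 1,  F_l'(0) = 0. *)
Definition ivp_solution (c D r eta_inf : R) (a : nat -> int -> W -> R[i])
    (u : R -> R -> R -> W -> R) : Prop :=
  forall eta, 0 <= eta < eta_inf ->
    L2_expansion (fun l => F_mode c D r eta_inf l eta) a (u eta).

End random_fields.

(* Main.v *)
Require Import Defs.
From HB Require Import structures.
From mathcomp Require Import all_boot all_order all_algebra.
From mathcomp Require Import all_classical all_reals all_analysis.
From mathcomp Require Import complex.
From mathcomp Require Import measurable_realfun ring lra zify.

(** The mode [F_l] solves [F'' + (2 nu - 1) / (eta_inf - eta) F' + z_l^2 F = 0]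
   with [F_l' (0) = 0], and the energy [F'^2 + z_l^2 F^2] is nonincreasing along
   this equation, so [|F_l'| <= z_l |F_l(0)|].  Moreover [F_l(0)] is [pi / 2]
   times the Wronskian [x (J_nu Y_(nu-1) - J_(nu-1) Y_nu)], which is independent
   of [x], hence of [l]; its exact value [2 / pi] is not needed.  Since [z_l] is
   of order [l], the squared increment of the [l]-th mode is [O(l^2 h^2)].  The
   coefficients [a_lm] are uncorrelated and the spherical harmonics are
   normalized, so the squared norm of the increment of [u] is at most a constant
   times [sum_l C_l (2 l + 1) l^2 h^2].

   All recurrences are read off the series [J_nu(x) = (x/2)^nu g_nu(x^2/4)], where
   [g_nu' = - g_(nu+1)] and [g_(nu-1)(y) = nu g_nu(y) - y g_(nu+1)(y)] follow from
   [s / Gamma(s+1) = 1 / Gamma(s)] alone.  For integer [nu] the estimate is obtained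
   as a limit of noninteger orders: [Y_mu] converges because [mu |-> J_mu] is
   differentiable at integers, which reduces to the differentiability of
   [1 / Gamma] at [1]. *)

Set Implicit Arguments.
Unset Strict Implicit.
Unset Printing Implicit Defensive.

Import Order.TTheory GRing.Theory Num.Theory.
Import numFieldNormedType.Exports.

Local Open Scope classical_set_scope.
Local Open Scope ring_scope.

(** * The reciprocal Gamma function *)

Section reciprocal_gamma.
Context {R : realType}.
Implicit Types (s x : R) (n k : nat).

(** The obstacle is [besselY] at integer order: it is defined there as a limit in the order, so
    neither a series nor the recurrences can be read off, and differentiability of [J_mu] in [mu]
    has to be built up from Gauss' product. This is why the modes are studied with a free order, and
    why the Lipschitz constant is kept in the form [|pi / 2 * wronskianJY nu| * z]: both sides of
    the estimate then converge as the order tends to an integer. The energy argument lives in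
    [s = eta_inf - eta], where the equation reads [F_ss - (2 nu - 1) / s F_s + z^2 F = 0];
    monotonicity asks for [nu >= 1/2], while here [nu > 1], which leaves room to perturb the order.
    The coefficients [K1] and [K2] are exactly those that make the derivative vanish at [eta = 0].
    On the probabilistic side the cross terms vanish in expectation at each fixed point of the
    sphere, so that only the integrals of the [|Y_lm|^2] remain to be computed. *)

Lemma is_cvg_shiftS (u : R^nat) : cvgn (fun n => u n.+1) -> cvgn u.
Proof. by move=> /cvg_ex[l ul]; apply/cvg_ex; exists l; rewrite -cvg_shiftS. Qed.

Definition gauss_prod s n : R :=
  (\prod_(k < n.+1) (s + k%:R)) / (n`!%:R * n%:R `^ s).

Lemma rgammaE s : rgamma s = limn (gauss_prod s).
Proof. by []. Qed.

(** The finite form of [s / Gamma(s+1) = 1 / Gamma(s)]: the two products share all factors but the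
    extreme ones, and the discrepancy [(s+n+1) / n] tends to 1. *)
Lemma gauss_prod_shift s n : (0 < n)%N ->
  s * gauss_prod (s + 1) n = gauss_prod s n * ((s + n.+1%:R) / n%:R).
Proof.
move=> n0.
have n0' : n%:R != 0 :> R by rewrite pnatr_eq0 -lt0n.
have H : s * \prod_(k < n.+1) (s + 1 + k%:R) =
         (\prod_(k < n.+1) (s + k%:R)) * (s + n.+1%:R).
  transitivity (\prod_(k < n.+2) (s + k%:R)).
    rewrite [RHS]big_ord_recl addr0; congr (_ * _).
    by apply: eq_bigr => i _; rewrite lift0 -natr1; ring.
  by rewrite big_ord_recr.
rewrite /gauss_prod powRD; last by rewrite n0' implybT.
rewrite powRr1 ?ler0n// mulrA H !invfM; ring.
Qed.

Lemma gauss_prod_ge0 s n : 0 <= s -> 0 <= gauss_prod s n.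
Proof.
move=> s0; rewrite divr_ge0// ?mulr_ge0 ?powR_ge0//.
by apply: prodr_ge0 => i _; rewrite addr_ge0.
Qed.

Lemma gauss_prod_step s n :
  gauss_prod s n.+2 =
  gauss_prod s n.+1 *
  ((1 + s / n.+2%:R) * expR (- (s * (ln n.+2%:R - ln n.+1%:R)))).
Proof.
have H m : m.+1%:R != 0 :> R by rewrite pnatr_eq0.
rewrite /gauss_prod /powR !pnatr_eq0/= [in LHS]big_ord_recr/= factS.
rewrite [in LHS]natrM !mulrBr opprB expRB.
field.
by rewrite !gt_eqF ?expR_gt0 ?ltr0n ?fact_gt0// nat1r ltr0n.
Qed.

Lemma ln_natS_ge n : (n.+2%:R)^-1 <= ln n.+2%:R - ln n.+1%:R :> R.
Proof.
rewrite -lerN2 opprB -ln_div ?posrE//.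
apply: le_trans (le_ln1Dx _); last first.
  by rewrite ltrN2 invf_lt1// ltr1n.
rewrite ler_ln ?posrE ?divr_gt0//; last by rewrite subr_gt0 invf_lt1// ltr1n.
by rewrite ler_pdivrMr// mulrBl mul1r mulVf// -[n.+2%:R]natr1 addrK.
Qed.

Lemma ln_natS_le n : ln n.+2%:R - ln n.+1%:R <= (n.+1%:R)^-1 :> R.
Proof.
rewrite -ln_div ?posrE//.
rewrite (_ : _ / _ = 1 + n.+1%:R^-1); first by rewrite le_ln1Dx// (lt_trans _ (_ : 0 < _))// ?invr_gt0// oppr_lt0.
by rewrite -natr1 mulrDl mulfV// mul1r.
Qed.

(** The sequence decreases from index 1 on: the quotient of consecutive terms is at most 1 because
    [1 + x <= e^x] and the increment of [ln] is at least [1 / (n+2)]. *)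
Lemma cvg_gauss_prod_ge0 s : 0 <= s -> cvgn (gauss_prod s).
Proof.
move=> s0; apply: is_cvg_shiftS; apply: nonincreasing_is_cvgn; last first.
  by exists 0 => _ [n _ <-]; exact: gauss_prod_ge0.
apply/nonincreasing_seqP => n; rewrite /= gauss_prod_step.
rewrite ler_piMr ?gauss_prod_ge0//.
rewrite expRN ler_pdivrMr ?expR_gt0// mul1r.
rewrite (le_trans (expR_ge1Dx _))// ler_expR ler_wpM2l//.
exact: ln_natS_ge.
Qed.

Lemma cvg_shift_ratio s : (s + n.+1%:R) / n%:R @[n --> \oo] --> (1 : R).
Proof.
rewrite -cvg_shiftS /=.
rewrite [X in X @ _ --> _](_ : _ = (fun n => 1 + (s + 1) * (n.+1%:R)^-1) :> (nat -> R)); last first.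
  by apply/funext => n; rewrite -!natr1; field; rewrite natr1 pnatr_eq0.
have H : 1 + (s + 1) * (n.+1%:R)^-1 @[n --> \oo] --> (1 + (s + 1) * 0 : R).
  by apply: cvgD; [exact: cvg_cst|apply: cvgMr; exact: cvg_harmonic].
by rewrite mulr0 addr0 in H.
Qed.

(** Convergence descends from [s + 1] to [s] by solving the shift identity for [gauss_prod s n],
    which is possible once [n > |s|]; finitely many descents start from a nonnegative argument. *)
Lemma cvg_gauss_prod s : cvgn (gauss_prod s).
Proof.
have [m sm] : exists m : nat, 0 <= s + m%:R.
  exists (Num.bound `|s|); move: (archi_boundP (normr_ge0 s)).
  by rewrite ltr_norml => /andP[+ _]; lra.
elim: m s sm => [|m IH] s; first by rewrite addr0; exact: cvg_gauss_prod_ge0.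
rewrite -natr1 [_ + 1]addrC addrA => /IH C.
have D : (s * gauss_prod (s + 1) n) * ((s + n.+1%:R) / n%:R)^-1 @[n --> \oo]
     --> (s * limn (gauss_prod (s + 1))) * (1 : R)^-1.
  apply: cvgM; first by apply: cvgMr.
  by apply: cvgV => //; exact: cvg_shift_ratio.
apply: cvgP; apply: cvg_trans D; apply: near_eq_cvg.
near=> n.
have n0 : (0 < n)%N by near: n; exact: nbhs_infty_gt.
rewrite gauss_prod_shift// mulfK//.
rewrite mulf_neq0// ?invr_eq0 ?pnatr_eq0 -?lt0n//.
rewrite gt_eqF//.
have : `|s| < n%:R by near: n; exact: nbhs_infty_gtr.
rewrite -natr1 ltr_norml; lra.
Unshelve. all: by end_near. Qed.

Lemma rgammaS s : s * rgamma (s + 1) = rgamma s.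
Proof.
have A : s * gauss_prod (s + 1) n @[n --> \oo] --> s * rgamma (s + 1).
  by apply: cvgMr; exact: cvg_gauss_prod.
have B : gauss_prod s n * ((s + n.+1%:R) / n%:R) @[n --> \oo] --> rgamma s * 1.
  by apply: cvgM; [exact: cvg_gauss_prod|exact: cvg_shift_ratio].
rewrite mulr1 in B; apply: (@cvg_unique _ _ _ _ _ _ A) => //.
apply: cvg_trans B; apply: near_eq_cvg.
near=> n; rewrite gauss_prod_shift//.
by near: n; exact: nbhs_infty_gt.
Unshelve. all: by end_near. Qed.

Lemma rgamma1 : rgamma 1 = 1 :> R.
Proof.
apply: (cvg_lim (@Rhausdorff R)).
have := @cvg_shift_ratio 0; apply: cvg_trans; apply: near_eq_cvg.
near=> n; have n0 : (0 < n)%N by near: n; exact: nbhs_infty_gt.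
have n0' : n%:R != 0 :> R by rewrite pnatr_eq0 -lt0n.
rewrite add0r /gauss_prod powRr1// (_ : \prod_(_ < _) _ = n.+1`!%:R).
  by rewrite factS natrM; field; rewrite n0' pnatr_eq0 -lt0n fact_gt0.
elim: (n.+1) => [|m IH]; first by rewrite big_ord0.
by rewrite big_ord_recr/= IH factS natrM nat1r mulrC.
Unshelve. all: by end_near. Qed.

(** Tends to Euler's constant. The sum has [n+1] terms to match the [n+1] factors of
    [gauss_prod]. *)
Definition euler_seq n : R := \sum_(k < n.+1) (k.+1%:R)^-1 - ln n%:R.

Lemma cvg_euler_seq : cvgn euler_seq.
Proof.
apply: is_cvg_shiftS; apply: nonincreasing_is_cvgn.
  apply/nonincreasing_seqP => n; rewrite /= /euler_seq big_ord_recr/=.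
  have := ln_natS_ge n.
  have : (n.+3%:R)^-1 <= (n.+2%:R)^-1 :> R by rewrite lef_pV2 ?posrE// ler_nat.
  move: (ln n.+2%:R) (ln n.+1%:R) (n.+3%:R^-1) (n.+2%:R^-1) (\sum_(k < _) _) => p q v w t; lra.
exists 0 => _ [n _ <-]; rewrite /= subr_ge0.
have H m : ln m.+1%:R <= \sum_(k < m) (k.+1%:R)^-1 :> R.
  elim: m => [|m IH]; first by rewrite ln1 big_ord0.
  rewrite big_ord_recr/=; move: IH (ln_natS_le m).
  by move: (ln _) (ln _) (_^-1) (\sum_(k < _) _) => p q v w; lra.
apply: (le_trans (H n)); rewrite [leRHS]big_ord_recr/= [X in X + _]big_ord_recr/=.
by rewrite -addrA lerDl addr_ge0.
Qed.

(** The counterpart of [1 + x <= e^x], through [x - 2 x^2 <= x / (1+x) <= ln (1+x)]; the first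
    inequality amounts to [x^2 (1 + 2x) >= 0], whence the range of [x]. *)
Lemma expR_le_1D x : - 2^-1 <= x -> expR (x - 2 * x ^+ 2) <= 1 + x.
Proof.
move=> x2; have x1 : 0 < 1 + x by lra.
apply: (@le_trans _ _ (expR (x / (1 + x)))).
  by rewrite ler_expR ler_pdivlMr//; nra.
rewrite -[x / _]opprK expRN -[leRHS]invrK lef_pV2 ?posrE ?expR_gt0 ?invr_gt0//.
apply: le_trans (expR_ge1Dx _).
by rewrite le_eqVlt; apply/orP; left; apply/eqP; field; lra.
Qed.

Lemma sum_inv_sqr_le n : \sum_(k < n.+1) (k.+1%:R ^+ 2)^-1 <= 2 - (n.+1%:R)^-1 :> R.
Proof.
elim: n => [|n IH]; first by rewrite big_ord_recr/= big_ord0; lra.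
rewrite big_ord_recr/=.
have : (n.+2%:R ^+ 2)^-1 <= (n.+1%:R)^-1 - (n.+2%:R)^-1 :> R.
  have a0 : 0 < n.+1%:R :> R by [].
  rewrite -[n.+2%:R]natr1.
  rewrite -subr_ge0 (_ : _ - _ = (n.+1%:R * (n.+1%:R + 1) ^+ 2)^-1); last first.
    by field; lra.
  by rewrite invr_ge0 mulr_ge0// exprn_ge0; lra.
move: IH; move: (\sum_(k < _) _) (_^-1) (_^-1) (_^-1) => p q v w; lra.
Qed.


(** Pulling [k+1] out of each factor [1 + x + k] leaves the Weierstrass form of the product, which
    can be compared with an exponential factor by factor. *)
Lemma gauss_prod_1D x n : (0 < n)%N ->
  gauss_prod (1 + x) n = n.+1%:R / n%:R *
    ((\prod_(k < n.+1) (1 + x / k.+1%:R)) * expR (- (x * ln n%:R))).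
Proof.
move=> n0; have n0' : n%:R != 0 :> R by rewrite pnatr_eq0 -lt0n.
have H m : \prod_(k < m) (1 + x + k%:R) =
           m`!%:R * \prod_(k < m) (1 + x / k.+1%:R) :> R.
  elim: m => [|m IH]; first by rewrite !big_ord0 mulr1.
  rewrite !big_ord_recr/= IH factS natrM -natr1; field.
  by rewrite natr1 pnatr_eq0.
rewrite /gauss_prod H powRD ?n0' ?implybT// powRr1// factS natrM.
rewrite {1}/powR (negbTE n0') expRN; field.
by rewrite !gt_eqF ?expR_gt0 ?ltr0n ?fact_gt0.
Qed.

Lemma gauss_prod_1D_le x n : (0 < n)%N -> `|x| <= 2^-1 ->
  gauss_prod (1 + x) n <= n.+1%:R / n%:R * expR (x * euler_seq n).
Proof.
move=> n0 x2; rewrite gauss_prod_1D// ler_wpM2l ?divr_ge0//.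
rewrite /euler_seq mulrBr expRD ler_wpM2r ?expR_ge0// mulr_sumr expR_sum.
apply: ler_prod => k _; rewrite expR_ge1Dx andbT.
have : `|x / k.+1%:R| <= 2^-1.
  rewrite normrM normfV (ger0_norm (ler0n _ _)) ler_pdivrMr//.
  by rewrite (le_trans x2)// ler_peMr// ler1n.
by rewrite ler_norml => /andP[+ _]; move: (x / _) => y; lra.
Qed.

(** Applied to each factor, [expR_le_1D] loses [2 x^2 / (k+1)^2]; the inverse squares sum to at most
    2, which gives the 4. *)
Lemma gauss_prod_1D_ge x n : (0 < n)%N -> `|x| <= 2^-1 ->
  expR (x * euler_seq n - 4 * x ^+ 2) <= gauss_prod (1 + x) n.
Proof.
move=> n0 x2; rewrite gauss_prod_1D//.
set q := _ * expR _; suff H : expR (x * euler_seq n - 4 * x ^+ 2) <= q.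
  rewrite (le_trans H)// ler_peMl//.
    by rewrite (le_trans _ H)// expR_ge0.
  by rewrite ler_pdivlMr ?ltr0n// mul1r ler_nat.
rewrite /q /euler_seq mulrBr addrAC [leLHS]expRD ler_wpM2r ?expR_ge0//.
apply: (@le_trans _ _ (expR (\sum_(k < n.+1) (x / k.+1%:R - 2 * (x / k.+1%:R) ^+ 2)))).
  rewrite ler_expR sumrB -mulr_sumr lerD2l lerN2 -mulr_sumr.
  under eq_bigr do rewrite expr_div_n.
  rewrite -mulr_sumr.
  have := sum_inv_sqr_le n; have : 0 <= n.+1%:R^-1 :> R by [].
  have := sqr_ge0 x.
  move: (_^-1) (\sum_(k < _) _) => p q' *; nra.
rewrite expR_sum; apply: ler_prod => k _; rewrite expR_ge0/= expR_le_1D//.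
have : `|x / k.+1%:R| <= 2^-1.
  rewrite normrM normfV (ger0_norm (ler0n _ _)) ler_pdivrMr//.
  by rewrite (le_trans x2)// ler_peMr// ler1n.
by rewrite ler_norml => /andP[+ _]; move: (x / _) => y; lra.
Qed.

(** Turns an explicit quadratic remainder into a derivative. It serves twice: for [rgamma] at 1, and
    for a series differentiated with respect to the order. *)
Lemma is_derive_quadratic (f : R -> R) a d B e : 0 < e ->
  (forall x, `|x| < e -> `|f (a + x) - f a - d * x| <= B * x ^+ 2) ->
  is_derive a 1 f d.
Proof.
move=> e0 H.
have C : h^-1 *: (f (h%:A + a) - f a) @[h --> 0^'] --> d.
  apply/cvgrPdist_le => eps eps0; near=> h.
  have h0 : h != 0 by near: h; exact: nbhs_dnbhs_neq.
  have he : `|h| < e by near: h; apply: dnbhs0_lt.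
  have hB : `|h| < eps / (`|B| + 1).
    by near: h; apply: dnbhs0_lt; rewrite divr_gt0// ltr_wpDl.
  rewrite -normrN opprB (_ : _ - d = h^-1 * (f (a + h) - f a - d * h)); last first.
    by rewrite /GRing.scale/= mulr1 [h + a]addrC; field.
  rewrite normrM normfV ler_pdivrMl ?normr_gt0//.
  rewrite (le_trans (H _ he))// -real_normK ?num_real// expr2 mulrA [leRHS]mulrC.
  rewrite ler_wpM2r//.
  move: hB; rewrite ltr_pdivlMr ?ltr_wpDl//.
  have := ler_norm B; have := normr_ge0 h; nra.
have D : derivable f a 1 by apply: cvgP C.
by apply: DeriveDef => //; apply: (cvg_lim (@Rhausdorff R)).
Unshelve. all: by end_near. Qed.

Let gamma := limn euler_seq.

Lemma rgamma_1D_le x : `|x| <= 2^-1 -> rgamma (1 + x) <= expR (x * gamma).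
Proof.
move=> x2.
have A : n.+1%:R / n%:R * expR (x * euler_seq n) @[n --> \oo] -->
         (1 * expR (x * gamma) : R).
  apply: cvgM; first by under eq_cvg do rewrite -[X in X / _]add0r; exact: cvg_shift_ratio.
  apply: continuous_cvg; first exact: continuous_expR.
  by apply: cvgMr; exact: cvg_euler_seq.
rewrite mul1r in A; rewrite -(cvg_lim (@Rhausdorff R) A) rgammaE.
apply: ler_lim; [exact: cvg_gauss_prod|exact: cvgP A|].
near=> n; apply: gauss_prod_1D_le => //.
by near: n; exact: nbhs_infty_gt.
Unshelve. all: by end_near. Qed.

Lemma rgamma_1D_ge x : `|x| <= 2^-1 ->
  expR (x * gamma - 4 * x ^+ 2) <= rgamma (1 + x).
Proof.
move=> x2.
have A : expR (x * euler_seq n - 4 * x ^+ 2) @[n --> \oo] -->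
         expR (x * gamma - 4 * x ^+ 2).
  apply: continuous_cvg; first exact: continuous_expR.
  apply: cvgB; last exact: cvg_cst.
  by apply: cvgMr; exact: cvg_euler_seq.
rewrite -(cvg_lim (@Rhausdorff R) A) rgammaE.
apply: ler_lim; [exact: cvgP A|exact: cvg_gauss_prod|].
near=> n; apply: gauss_prod_1D_ge => //.
by near: n; exact: nbhs_infty_gt.
Unshelve. all: by end_near. Qed.

(** Near 1 the function is squeezed between [e^(gamma x - 4 x^2)] and [e^(gamma x)], which have the
    same tangent at [x = 0]. *)
Lemma derivable_rgamma1 : derivable rgamma (1 : R) 1.
Proof.
suff [d H] : exists d, is_derive (1 : R) 1 rgamma d by exact: (@ex_derive _ _ _ _ _ _ _ H).
(* This radius forces both [|x| <= 1/2] and [|gamma x| <= 1/2], the ranges of the exponential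
   bounds. *)
exists gamma; pose e := (2 * (`|gamma| + 1))^-1.
have g0 := normr_ge0 gamma.
have e0 : 0 < e by rewrite invr_gt0; lra.
(* The part [2 gamma^2] comes from [e^y <= 1 + y + 2 y^2] at [y = gamma x], the part 4 from the
   lower bound. *)
apply: (@is_derive_quadratic _ _ _ (2 * gamma ^+ 2 + 4) e) => // x xe.
have xg : `|x| * (2 * (`|gamma| + 1)) < 1.
  by rewrite -ltr_pdivlMr ?div1r//; lra.
have x0 := normr_ge0 x.
have x2 : `|x| <= 2^-1 by nra.
have : `|x * gamma| <= 2^-1 by rewrite normrM; nra.
rewrite rgamma1.
have L := le_trans (expR_ge1Dx _) (rgamma_1D_ge x2).
have U := rgamma_1D_le x2.
rewrite ler_norml => /andP[_]; set y := x * gamma => y2.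
have U' : expR y <= 1 + y + 2 * y ^+ 2.
  rewrite -[y in expR y]opprK expRN -[leRHS]invrK lef_pV2 ?posrE ?expR_gt0//; last first.
    by rewrite invr_gt0; nra.
  apply: le_trans (expR_ge1Dx _).
  rewrite -div1r ler_pdivrMr; last nra.
  have := sqr_ge0 y; nra.
have Hy : y ^+ 2 = gamma ^+ 2 * x ^+ 2 by rewrite /y exprMn mulrC.
have := sqr_ge0 x; have := sqr_ge0 gamma.
by rewrite ler_norml; move: L U U'; rewrite Hy -/y -[gamma * x]mulrC -/y; nra.
Qed.

Lemma derivable_shift (f : R -> R) (a k : R) :
  derivable f (a + k) 1 -> derivable (fun t => f (t + k)) a 1.
Proof.
rewrite /derivable [X in cvg (X @ _) -> _](_ : _ =
  (fun h => h^-1 *: (f (h *: 1 + a + k) - f (a + k)))) //=.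
by apply/funext => h /=; rewrite addrA.
Qed.

(** The functional equation carries differentiability upwards from 1 by a division, legitimate at
    [s != 0], and downwards through 0 by a multiplication. *)
Lemma derivable_rgamma_int (m : int) : derivable rgamma (m%:~R : R) 1.
Proof.
have up s : s != 0 -> derivable rgamma s 1 -> derivable rgamma (s + 1) (1 : R).
  move=> s0 Ds.
  apply: (@near_eq_derivable R R^o R^o (fun t => rgamma (t - 1) / (t - 1))).
    have : \forall t \near s + 1, t != (1 : R).
      have : s + 1 != 1 by rewrite -subr_eq0 addrK.
      by move/open_neq; apply.
    apply: filterS => t t1.
    by rewrite -[in LHS]rgammaS subrK mulrC mulKf// subr_eq0.
  apply: derivableM.
    by apply: derivable_shift; rewrite addrK.
  apply: derivableV; first by rewrite addrK.
  by apply: derivableB => //; exact: derivable_id.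
have down s : derivable rgamma (s + 1) 1 -> derivable rgamma s (1 : R).
  move=> Ds; rewrite [X in derivable X](_ : _ = (fun t => t * rgamma (t + 1))); last first.
    by apply/funext => t; rewrite rgammaS.
  by apply: derivableM; [exact: derivable_id|exact: derivable_shift].
have pos n : derivable rgamma (n.+1%:R : R) 1.
  elim: n => [|n IH]; first exact: derivable_rgamma1.
  by rewrite -natr1; apply: up => //; rewrite pnatr_eq0.
have neg n : derivable rgamma (- n%:R : R) 1.
  elim: n => [|n IH]; apply: down; first by rewrite oppr0 add0r; exact: derivable_rgamma1.
  by rewrite -natr1 opprD addrNK.
case: m => [[|n]|n]; first by rewrite -[_%:~R]oppr0; exact: (neg 0%N).
  exact: pos.
by rewrite NegzE rmorphN; exact: neg.
Qed.

End reciprocal_gamma.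

(** * Bessel functions *)

Section bessel_series.
Context {R : realType}.
Implicit Types (mu nu x y s t : R) (n k : nat).

(** Once [k + mu >= 0], [rgamma s = s * rgamma (s+1)] with [s >= 1] makes the absolute values
    nonincreasing; the finitely many earlier ones are added to the bound. *)
Lemma rgamma_shift_bounded mu : exists M : R, forall k, `|rgamma (k%:R + mu + 1)| <= M.
Proof.
pose N := Num.bound `|mu|.
have N0 : 0 <= N%:R + mu.
  move: (archi_boundP (normr_ge0 mu)); rewrite -/N ltr_norml => /andP[+ _]; lra.
have H j : `|rgamma (j%:R + (N%:R + mu) + 1)| <= `|rgamma (N%:R + mu + 1)|.
  elim: j => [|j IH]; first by rewrite add0r.
  apply: le_trans IH; rewrite -(rgammaS (j%:R + (N%:R + mu) + 1)) normrM.
  have -> : j.+1%:R + (N%:R + mu) + 1 = j%:R + (N%:R + mu) + 1 + 1 :> R.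
    by rewrite -natr1; ring.
  apply: ler_peMl; first exact: normr_ge0.
  apply: le_trans (ler_norm _); rewrite lerDr.
  by apply: addr_ge0 => //; exact: ler0n.
exists (\sum_(i < N) `|rgamma (i%:R + mu + 1)| + `|rgamma (N%:R + mu + 1)|) => k.
have [kN|Nk] := ltnP k N.
  by rewrite (bigD1 (Ordinal kN))//= -[leRHS]addrA lerDl addr_ge0// sumr_ge0.
by rewrite -(subnK Nk) natrD -(addrA _ N%:R) (le_trans (H _))// lerDr sumr_ge0.
Qed.

Lemma is_cvg_seriesMl (c : R) (u : R^nat) :
  cvgn (series u) -> cvgn (series (fun k => c * u k)).
Proof. exact: is_cvg_seriesZ. Qed.

Lemma lim_seriesMl (c : R) (u : R^nat) :
  cvgn (series u) -> limn (series (fun k => c * u k)) = c * limn (series u).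
Proof. exact: lim_seriesZ. Qed.

Lemma is_cvg_series_dominated (u : R^nat) M z :
  (forall k, `|u k| <= M * exp_coeff z k) -> cvgn (series u).
Proof.
move=> H; apply: normed_cvg; apply: series_le_cvg (H) _ => //.
  by move=> k; rewrite (le_trans _ (H k)).
apply: is_cvg_seriesMl; exact: is_cvg_series_exp_coeff.
Qed.

Definition gcoef mu k : R := (-1) ^+ k / k`!%:R * rgamma (k%:R + mu + 1).

Lemma norm_gcoef mu k : `|gcoef mu k| = `|rgamma (k%:R + mu + 1)| / k`!%:R.
Proof.
by rewrite /gcoef !normrM normrX normrN1 expr1n mul1r normfV normr_nat mulrC.
Qed.

(** The function [g_mu] of the overview, that is the Bessel-Clifford function of order [mu] at
    [-y]. *)
Definition gser mu y : R := limn (pseries (gcoef mu) y).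

Lemma is_cvg_gser mu y : cvgn (pseries (gcoef mu) y).
Proof.
have [M HM] := rgamma_shift_bounded mu.
have H k : `|gcoef mu k * y ^+ k| <= M * exp_coeff `|y| k.
  rewrite normrM norm_gcoef normrX /exp_coeff mulrAC -mulrA.
  by rewrite ler_wpM2r// divr_ge0.
exact: (is_cvg_series_dominated H).
Qed.

Lemma pseries_diffs_gcoef mu : pseries_diffs (gcoef mu) = - gcoef (mu + 1).
Proof.
apply/funext => k; rewrite /pseries_diffs !fctE /gcoef exprS factS natrM.
have -> : k.+1%:R + mu + 1 = k%:R + (mu + 1) + 1 :> R by rewrite -natr1; ring.
by field; rewrite nat1r !pnatr_eq0 -lt0n fact_gt0.
Qed.

Lemma is_derive_gser mu y : is_derive y 1 (gser mu) (- gser (mu + 1) y).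
Proof.
have E nu z : pseries (- gcoef nu) z = - pseries (gcoef nu) z.
  apply/funext => n; change (\sum_(0 <= i < n) - gcoef nu i * z ^+ i =
    - \sum_(0 <= i < n) gcoef nu i * z ^+ i).
    by rewrite -sumrN; apply: eq_bigr => i _; rewrite mulNr.
have C nu z : cvgn (pseries (- gcoef nu) z).
  by rewrite E; apply: is_cvgN; exact: is_cvg_gser.
(* Termwise differentiation requires a radius, here [|y| + 1], at which the series and its first two
   formal derivatives converge; these are again series of the same kind, of orders [mu + 1] and
   [mu + 2]. *)
have := @pseries_snd_diffs R (gcoef mu) (`|y| + 1) y.
rewrite pseries_diffs_gcoef pseries_diffsN pseries_diffs_gcoef opprK.
move=> /(_ (@is_cvg_gser _ _) (C _ _) (@is_cvg_gser _ _)).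
rewrite E limN; last exact: is_cvg_gser.
by apply; rewrite [ltRHS]ger0_norm ?addr_ge0// ltrDl.
Qed.

(** Coefficientwise, [1 / Gamma(k+mu) = (k+mu) / Gamma(k+mu+1)]: the summand [mu] gives the first
    term, the summand [k] cancels against [k!] and shifts the index by one. Hence the partial sums
    of unequal lengths. *)
Lemma gser_rec mu y : gser (mu - 1) y = mu * gser mu y - y * gser (mu + 1) y.
Proof.
have A : pseries (gcoef (mu - 1)) y n.+1 @[n --> \oo] --> gser (mu - 1) y.
  by rewrite (cvg_shiftS (pseries (gcoef (mu - 1)) y)); exact: is_cvg_gser.
have B : mu * pseries (gcoef mu) y n.+1 - y * pseries (gcoef (mu + 1)) y n
   @[n --> \oo] --> mu * gser mu y - y * gser (mu + 1) y.
  apply: cvgB; apply: cvgMr; last exact: is_cvg_gser.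
  by rewrite -/(gser mu y) (cvg_shiftS (pseries (gcoef mu) y)); exact: is_cvg_gser.
suff E : (fun n => pseries (gcoef (mu - 1)) y n.+1) =
    (fun n => mu * pseries (gcoef mu) y n.+1 - y * pseries (gcoef (mu + 1)) y n).
  by rewrite E in A; rewrite -(cvg_lim (@Rhausdorff R) A) (cvg_lim (@Rhausdorff R) B).
apply/funext => n; rewrite /pseries /series/= !big_mkord.
have E k : gcoef (mu - 1) k * y ^+ k - mu * (gcoef mu k * y ^+ k) =
           k%:R * (gcoef mu k * y ^+ k).
  rewrite /gcoef -[in X in X * _ - _](rgammaS (k%:R + (mu - 1) + 1)).
  rewrite (_ : k%:R + (mu - 1) + 1 = k%:R + mu); last ring.
  by ring.
suff : \sum_(k < n.+1) gcoef (mu - 1) k * y ^+ k -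
       mu * \sum_(k < n.+1) gcoef mu k * y ^+ k =
       - (y * \sum_(k < n) gcoef (mu + 1) k * y ^+ k).
  by move/(canRL (subrK _)) => ->; rewrite addrC.
rewrite !mulr_sumr -sumrB -sumrN.
under eq_bigr do rewrite E.
rewrite big_ord_recl mul0r add0r; apply: eq_bigr => k _.
have /= := congr1 (fun f : R^nat => f k) (pseries_diffs_gcoef mu).
rewrite /pseries_diffs fctE /bump leq0n add1n exprS => G.
by rewrite mulrA G; ring.
Qed.


Lemma besselJE nu x : 0 < x ->
  besselJ nu x = (x / 2) `^ nu * gser nu ((x / 2) ^+ 2).
Proof.
move=> x0; have x2 : 0 < x / 2 by rewrite divr_gt0.
rewrite /besselJ /gser.
rewrite -lim_seriesMl; last exact: is_cvg_gser.
congr (limn (series _)); apply/funext => k.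
rewrite powRD; last by rewrite (gt_eqF x2) implybT.
by rewrite powR_mulrn 1?ltW//= -exprM mul2n /gcoef; ring.
Qed.

(** The ratio [Gamma(s+1) / Gamma(s+k+1)]. It isolates from the coefficients of [gser] a rational
    function of the order, which can be estimated for all [k] at once. *)
Definition rising_inv s k : R := \prod_(j < k) (s + 1 + j%:R)^-1.

Lemma gcoef_rising mu k : 0 <= mu ->
  gcoef mu k = rgamma (mu + 1) * ((-1) ^+ k / k`!%:R * rising_inv mu k).
Proof.
move=> mu0; suff : rgamma (k%:R + mu + 1) = rgamma (mu + 1) * rising_inv mu k.
  by rewrite /gcoef => ->; ring.
elim: k => [|k IH]; first by rewrite add0r /rising_inv big_ord0 mulr1.
rewrite /rising_inv big_ord_recr/= mulrA -IH -(rgammaS (k%:R + mu + 1)).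
rewrite (_ : k.+1%:R + mu + 1 = k%:R + mu + 1 + 1); last by rewrite -natr1; ring.
rewrite (_ : mu + 1 + k%:R = k%:R + mu + 1); last by ring.
by rewrite mulrAC mulfV ?mul1r// gt_eqF// ltr_wpDl// addr_ge0.
Qed.

(** By induction on [k]: the new factor [1 / (t+1+k)] lies in [[0, 1]], is 1-Lipschitz and differs
    from its linearization by at most [(t-s)^2], so the product rule leaves at most three error
    terms, each of size [3^k]. The growth [3^k] is harmless against the [k!] of the series. *)
Lemma rising_inv_quadratic s : 0 <= s -> forall k, exists d, `|d| <= 3 ^+ k /\
  forall t, 0 <= t -> [/\ `|rising_inv t k| <= 1,
    `|rising_inv t k - rising_inv s k| <= 3 ^+ k * `|t - s| &
    `|rising_inv t k - rising_inv s k - d * (t - s)| <= 3 ^+ k * (t - s) ^+ 2].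
Proof.
move=> s0; elim=> [|k [d [dk IH]]].
  exists 0; split; first by rewrite normr0.
  by move=> t t0; rewrite /rising_inv !big_ord0 subrr normr1 mul0r subr0 normr0 expr0 !mul1r sqr_ge0.
pose a t : R := (t + 1 + k%:R)^-1.
have a1 t : 0 <= t -> 0 <= a t <= 1.
  move=> t0; rewrite /a; have := ler0n R k; move: (k%:R) => K K0.
  have K1 : 0 < t + 1 + K by lra.
  by rewrite invr_ge0 invf_le1// ltW//=; lra.
have a2 t : 0 <= t -> a t - a s = - (t - s) * a t * a s.
  move=> t0; rewrite /a; have := ler0n R k; move: (k%:R) => K K0.
  by field; apply/andP; split; rewrite gt_eqF//; lra.
have rS t : rising_inv t k.+1 = rising_inv t k * a t.
  by rewrite /rising_inv big_ord_recr.
have [s1 _ _] := IH s s0.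
have /andP[as0 as1] := a1 _ s0.
have p1 : 1 <= 3 ^+ k :> R by rewrite exprn_ege1// ler1n.
have na u : 0 <= u -> `|a u| <= 1.
  by move=> /a1 /andP[? ?]; rewrite ger0_norm.
have na1 := na _ s0.
(* The product rule, with [a' = - a^2]. *)
exists (- (a s * a s * rising_inv s k) + a s * d); split.
  rewrite (le_trans (ler_normD _ _))// normrN !normrM exprS.
  have -> : 3 * 3 ^+ k = 3 ^+ k + 3 ^+ k + 3 ^+ k :> R by ring.
  have : `|a s| * `|a s| * `|rising_inv s k| <= 1 by rewrite !mulr_ile1// mulr_ge0.
  have : `|a s| * `|d| <= 3 ^+ k by rewrite (le_trans _ dk)// ler_piMl.
  by move: (3 ^+ k) p1 (_ * _) (_ * _) => p *; lra.
move=> t t0; have [t1 tL tQ] := IH t t0.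
have nat1 := na _ t0; have := a2 _ t0 => Ea.
have nd : `|a t - a s| <= `|t - s|.
  by rewrite Ea !normrM normrN -mulrA ler_piMr// mulr_ile1.
rewrite !rS; split.
- by rewrite normrM mulr_ile1.
- have -> : rising_inv t k * a t - rising_inv s k * a s =
     (rising_inv t k - rising_inv s k) * a t + rising_inv s k * (a t - a s) by ring.
  rewrite (le_trans (ler_normD _ _))// exprS.
  have -> : 3 * 3 ^+ k * `|t - s| = 3 ^+ k * `|t - s| + (3 ^+ k + 3 ^+ k) * `|t - s| by ring.
  apply: lerD.
    by rewrite normrM (le_trans _ tL)// ler_piMr.
  rewrite normrM; apply: ler_pM => //; rewrite (le_trans s1)//.
  by rewrite (le_trans p1)// lerDl exprn_ge0.
- have -> : rising_inv t k * a t - rising_inv s k * a s -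
     (- (a s * a s * rising_inv s k) + a s * d) * (t - s) =
     (rising_inv t k - rising_inv s k - d * (t - s)) * a s +
     (rising_inv t k - rising_inv s k) * (a t - a s) +
     rising_inv s k * (a t - a s + (t - s) * (a s * a s)) by ring.
  rewrite (_ : a t - a s + _ = (t - s) ^+ 2 * (a s * a s * a t)); last first.
    have -> : a t - a s + (t - s) * (a s * a s) = a t - a s + (t - s) * a t * a s - (t - s) * a s * (a t - a s) by ring.
    by rewrite Ea; ring.
  rewrite [3 ^+ k.+1]exprS (_ : 3 * 3 ^+ k * (t - s) ^+ 2 = 3 ^+ k * (t - s) ^+ 2 + 3 ^+ k * (t - s) ^+ 2 + 3 ^+ k * (t - s) ^+ 2); last by ring.
  apply: (le_trans (ler_normD _ _)); apply: lerD; last first.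
    rewrite normrM [`|_ ^+ 2 * _|]normrM (ger0_norm (sqr_ge0 _)) mulrCA mulrC.
    rewrite ler_wpM2r ?sqr_ge0// (le_trans _ p1)// !normrM mulr_ile1 ?mulr_ge0//.
    by rewrite !mulr_ile1// mulr_ge0.
  apply: (le_trans (ler_normD _ _)); apply: lerD.
    by rewrite normrM (le_trans _ tQ)// ler_piMr.
  rewrite normrM -[(t - s) ^+ 2]ger0_norm ?sqr_ge0// normrX expr2 mulrA.
  by apply: ler_pM.
Qed.

(** Orders within distance 1 of [n+1] are nonnegative, so there [gser t y = rgamma (t+1) * h t],
    where [h] carries the rational coefficients [rising_inv]. The remainders of [h] sum to at most
    [x^2 e^(3|y|)]. *)
Lemma derivable_gser_pos n y : derivable (gser ^~ y) (n.+1%:R : R) 1.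
Proof.
pose c k : R := (- y) ^+ k / k`!%:R.
have nc k : `|c k| = exp_coeff `|y| k.
  by rewrite /c /exp_coeff normrM normrX normrN normfV normr_nat.
have nc3 k : `|c k| * 3 ^+ k = 1 * exp_coeff (3 * `|y|) k.
  by rewrite nc /exp_coeff/= exprMn mul1r mulrAC [_ * 3 ^+ k]mulrC.
pose h s := limn (series (fun k => c k * rising_inv s k)).
have s0 : 0 <= n.+1%:R :> R by [].
have /choice[d Hd] := rising_inv_quadratic s0.
have ch t : 0 <= t -> cvgn (series (fun k => c k * rising_inv t k)).
  move=> t0; apply: (@is_cvg_series_dominated _ 1 `|y|) => k.
  have [_ /(_ _ t0)[r1 _ _]] := Hd k.
  by rewrite normrM nc mul1r ler_piMr// -nc.
have cd : cvgn (series (fun k => c k * d k)).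
  apply: (@is_cvg_series_dominated _ 1 (3 * `|y|)) => k.
  have [dk _] := Hd k.
  by rewrite -nc3 normrM ler_wpM2l.
have gE t : 0 <= t -> gser t y = rgamma (t + 1) * h t.
  move=> t0; rewrite /gser /h.
  rewrite -lim_seriesMl; last exact: ch.
  congr (limn (series _)); apply/funext => k.
  by rewrite /= gcoef_rising// /c (exprNn y); ring.
have Dh : derivable h (n.+1%:R : R) 1.
  suff H : is_derive (n.+1%:R : R) 1 h (limn (series (fun k => c k * d k))) by exact: (@ex_derive _ _ _ _ _ _ _ H).
  apply: (@is_derive_quadratic _ _ _ _ (limn (series (exp_coeff (3 * `|y|)))) 1) => // x x1.
  have t0 : 0 <= n.+1%:R + x.
    move: x1; rewrite ltr_norml => /andP[x1 _].
    by have : 1 <= n.+1%:R :> R; [rewrite ler1n|move: (_%:R) => N; lra].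
  pose u k := c k * (rising_inv (n.+1%:R + x) k - rising_inv n.+1%:R k - d k * x).
  have uL : h (n.+1%:R + x) - h n.+1%:R - limn (series (fun k => c k * d k)) * x = limn (series u).
    rewrite mulrC -lim_seriesMl//.
    rewrite /h -lim_seriesB; [|exact: ch|exact: ch].
    rewrite -lim_seriesB; [|apply: is_cvg_seriesB; exact: ch|exact: is_cvg_seriesMl].
    congr (limn (series _)); apply/funext => k.
    change (c k * rising_inv (n.+1%:R + x) k - c k * rising_inv n.+1%:R k - x * (c k * d k) = u k).
    by rewrite /u; ring.
  have uE k : `|u k| <= x ^+ 2 * exp_coeff (3 * `|y|) k.
    rewrite /u normrM -[exp_coeff _ _]mul1r -nc3.
    have [_ /(_ _ t0)[_ _]] := Hd k; rewrite [_ + x - _]addrAC subrr add0r => Q.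
    by rewrite [leRHS]mulrCA ler_wpM2l// [leRHS]mulrC.
  have ce := is_cvg_series_exp_coeff (3 * `|y|).
  have nu : cvgn [normed series u].
    apply: series_le_cvg (uE) _ => //.
      by move=> k; rewrite (le_trans _ (uE k)).
    exact: is_cvg_seriesMl.
  rewrite uL (le_trans (lim_series_norm nu))// mulrC.
  rewrite -lim_seriesMl//.
  by apply: lim_series_le => //; exact: is_cvg_seriesMl.
apply: (@near_eq_derivable R R^o R^o (fun t => rgamma (t + 1) * h t)).
  have : \forall t \near (n.+1%:R : R), 0 < t by exact: lt_nbhsr.
  by apply: filterS => t t0; rewrite gE// ltW.
have Ds : derivable rgamma (n.+1%:R + 1 : R) 1.
  by rewrite natr1; exact: (@derivable_rgamma_int R n.+2).
exact: (derivableM (@derivable_shift R rgamma n.+1%:R 1 Ds) Dh).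
Qed.

(** The recurrence [g_s = (s+1) g_(s+1) - y g_(s+2)] extends differentiability downwards; it uses
    two orders, so the induction carries a pair. *)
Lemma derivable_gser_int (m : int) y : derivable (gser ^~ y) (m%:~R : R) 1.
Proof.
have down s : derivable (gser ^~ y) (s + 1) 1 -> derivable (gser ^~ y) (s + 2) 1 ->
    derivable (gser ^~ y) s (1 : R).
  move=> D1 D2; rewrite [X in derivable X](_ : _ = (fun t => (t + 1) * gser (t + 1) y - y * gser (t + 2) y)).
    have E1 := @derivable_shift R (gser ^~ y) s 1 D1.
    have E2 := @derivable_shift R (gser ^~ y) s 2 D2.
    have E3 : derivable (fun t : R => t + 1) s 1.
      by apply: derivableD; [exact: derivable_id|exact: derivable_cst].
    apply: derivableB; first exact: (derivableM E3 E1).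
    exact: (derivableM (@derivable_cst _ _ _ y s 1) E2).
  apply/funext => t; have := gser_rec (t + 1) y; rewrite addrK => ->.
  by rewrite -addrA.
have neg n : derivable (gser ^~ y) (1%:R - n%:R : R) 1 /\ derivable (gser ^~ y) (2%:R - n%:R : R) 1.
  elim: n => [|n [IH1 IH2]].
    by rewrite !subr0; split; exact: derivable_gser_pos.
  have -> : 1%:R - n.+1%:R = - n%:R :> R by rewrite -natr1; ring.
  have -> : 2%:R - n.+1%:R = 1%:R - n%:R :> R by rewrite -natr1; ring.
  split; last exact: IH1.
  by apply: down; rewrite addrC; [exact: IH1|exact: IH2].
case: m => [[|n]|n].
- have [+ _] := neg 1%N; rewrite (_ : 1%:R - 1%:R = 0%:~R :> R)//.
  by rewrite mulr0z; exact: subrr.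
- exact: derivable_gser_pos.
- rewrite NegzE rmorphN/=; have [+ _] := neg n.+2.
  rewrite (_ : 1%:R - n.+2%:R = - n.+1%:R :> R)//.
  by rewrite -[n.+2%:R]natr1; ring.
Qed.

(** The identity [J_(-n) = (-1)^n J_n] in terms of [g]; it makes the numerator of the quotient
    defining [Y_n] vanish. Both sides obey the same two-step recurrence. *)
Lemma gserN_nat n y : gser (- n%:R) y = (- y) ^+ n * gser n%:R y.
Proof.
suff : gser (- n%:R) y = (- y) ^+ n * gser n%:R y /\
  gser (- n.+1%:R) y = (- y) ^+ n.+1 * gser n.+1%:R y by case.
elim: n => [|n [IH1 IH2]].
  rewrite oppr0 expr0 mul1r; split; first by [].
  by have := gser_rec 0 y; rewrite sub0r add0r => ->; rewrite mul0r sub0r mulNr.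
split; first exact: IH2.
have E : - n.+1%:R + 1 = - n%:R :> R by rewrite -natr1; ring.
have := gser_rec (- n.+1%:R) y.
rewrite -opprD natr1 E => ->.
rewrite IH1 IH2 (_ : gser n%:R y = n.+1%:R * gser n.+1%:R y - y * gser n.+2%:R y).
  rewrite (exprS _ n.+1) (exprS _ n).
  move: (n.+1%:R) (gser n.+1%:R y) (gser n.+2%:R y) ((- y) ^+ n) => p q v w; ring.
by have := gser_rec n.+1%:R y; rewrite natr1 -natr1 addrK.
Qed.

End bessel_series.

(** * Recurrences, Wronskian and energy estimate for cylinder functions *)

Section bessel_relations.
Context {R : realType}.
Implicit Types (mu nu x y s t a k : R).

Lemma powR_half x nu : 0 < x -> (x / 2) `^ nu = x `^ nu * 2^-1 `^ nu.
Proof. by move=> x0; rewrite powRM// ltW. Qed.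

Lemma powR_sub1 x nu : 0 < x -> x `^ (nu - 1) = x `^ nu / x.
Proof. by move=> x0; rewrite powRB ?powRr1 ?ltW// (gt_eqF x0) implybT. Qed.

Lemma powR_add1 x nu : 0 < x -> x `^ (nu + 1) = x `^ nu * x.
Proof. by move=> x0; rewrite powRD ?powRr1 ?ltW// (gt_eqF x0) implybT. Qed.

Lemma is_derive_mul (f g : R -> R) x df dg :
  is_derive x 1 f df -> is_derive x 1 g dg ->
  is_derive x 1 (fun t => f t * g t) (df * g x + f x * dg).
Proof.
move=> Df Dg; apply: (@is_derive_eq _ _ _ _ _ _ _ _ (is_deriveM Df Dg)).
by rewrite /GRing.scale/=; ring.
Qed.

Lemma is_derive_comp (f g : R -> R) x df dg :
  is_derive (g x) 1 f df -> is_derive x 1 g dg ->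
  is_derive x 1 (fun t => f (g t)) (df * dg).
Proof. exact: is_derive1_comp. Qed.

Lemma is_derive_gser_half nu x :
  is_derive x 1 (fun t => gser nu ((t / 2) ^+ 2))
    (- gser (nu + 1) ((x / 2) ^+ 2) * (x / 2)).
Proof.
apply: (@is_derive_comp (gser nu) (fun t => (t / 2) ^+ 2)).
  exact: is_derive_gser.
have D : is_derive x 1 (fun t : R => t * 2^-1) 2^-1.
  apply: (@is_derive_eq _ _ _ _ _ _ _ _ (is_derive_mul (is_derive_id x 1) (is_derive_cst (2^-1 : R) x 1))).
  by rewrite mulr0 addr0 mul1r.
apply: (@is_derive_eq _ _ _ _ _ _ _ _ (is_derive_mul D D)).
by field.
Qed.

Lemma near_gt0 x : 0 < x -> \forall t \near x, 0 < t.
Proof. by move=> x0; exact: lt_nbhsr. Qed.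

Lemma is_derive_besselJ_raise nu x : 0 < x ->
  is_derive x 1 (fun t => t `^ nu * besselJ nu t) (x `^ nu * besselJ (nu - 1) x).
Proof.
move=> x0; have x2 : 0 < x / 2 by rewrite divr_gt0.
apply: (@near_eq_is_derive R R^o R^o (fun t => (t `^ nu * t `^ nu) * (2^-1 `^ nu * gser nu ((t / 2) ^+ 2)))).
  apply: filterS (near_gt0 x0) => t t0.
  by rewrite besselJE// powR_half//; ring.
have D1 := is_derive1_powR nu x0.
have D2 := is_derive_mul (is_derive_cst (2^-1 `^ nu : R) x 1) (is_derive_gser_half nu x).
apply: (@is_derive_eq _ _ _ _ _ _ _ _ (is_derive_mul (is_derive_mul D1 D1) D2)).
rewrite besselJE// gser_rec (powR_sub1 _ x2) (powR_sub1 _ x0) powR_half//=.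
move: (x `^ nu) (2^-1 `^ nu) (gser nu _) (gser (nu + 1) _) => p q g1 g2.
by field; rewrite gt_eqF.
Qed.

Lemma is_derive_besselJ_lower nu x : 0 < x ->
  is_derive x 1 (fun t => t `^ (- nu) * besselJ nu t)
    (- (x `^ (- nu) * besselJ (nu + 1) x)).
Proof.
move=> x0; have x2 : 0 < x / 2 by rewrite divr_gt0.
apply: (@near_eq_is_derive R R^o R^o (fun t => 2^-1 `^ nu * gser nu ((t / 2) ^+ 2))).
  apply: filterS (near_gt0 x0) => t t0.
  rewrite besselJE// powR_half// powRN; field.
  by rewrite gt_eqF// powR_gt0.
have D2 := is_derive_mul (is_derive_cst (2^-1 `^ nu : R) x 1) (is_derive_gser_half nu x).
apply: (@is_derive_eq _ _ _ _ _ _ _ _ D2).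
rewrite besselJE// (powR_add1 _ x2) powR_half// powRN/=.
have : x `^ nu != 0 by rewrite gt_eqF// powR_gt0.
move: (x `^ nu) (2^-1 `^ nu) (gser (nu + 1) _) => p q g1 p0.
by field.
Qed.

(* The recurrences satisfied by a Bessel function Z of order nu and its
   companion Z1 of order nu - 1. *)
Definition cylinder_pair nu (Z Z1 : R -> R) := forall x, 0 < x ->
  is_derive x 1 (fun t => t `^ nu * Z t) (x `^ nu * Z1 x) /\
  is_derive x 1 (fun t => t `^ (1 - nu) * Z1 t) (- (x `^ (1 - nu) * Z x)).

Lemma cylinder_pairJ nu : cylinder_pair nu (besselJ nu) (besselJ (nu - 1)).
Proof.
move=> x x0; split; first exact: is_derive_besselJ_raise.
have := is_derive_besselJ_lower (nu - 1) x0.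
by rewrite subrK opprB.
Qed.

Lemma cylinder_pairJN nu :
  cylinder_pair nu (besselJ (- nu)) (fun x => - besselJ (1 - nu) x).
Proof.
move=> x x0; split.
  have := is_derive_besselJ_lower (- nu) x0.
  by rewrite opprK addrC mulrN.
have /(@is_deriveN _ _ _ _ _ _ _) := is_derive_besselJ_raise (1 - nu) x0.
rewrite [1 - nu - 1]addrAC subrr sub0r.
by rewrite (_ : - (fun t => _) = (fun t => t `^ (1 - nu) * - besselJ (1 - nu) t))//;
  apply/funext => t; rewrite mulrN.
Qed.

Lemma cylinder_pair_lin nu (p q : R) (Z Z1 V V1 : R -> R) :
  cylinder_pair nu Z Z1 -> cylinder_pair nu V V1 ->
  cylinder_pair nu (fun x => p * Z x + q * V x) (fun x => p * Z1 x + q * V1 x).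
Proof.
move=> HZ HV x x0; have [Z2 Z3] := HZ x x0; have [V2 V3] := HV x x0.
have L (f g : R -> R) df dg : is_derive x 1 f df -> is_derive x 1 g dg ->
    is_derive x 1 (fun t => p * f t + q * g t) (p * df + q * dg).
  move=> Df Dg; apply: (@is_derive_eq _ _ _ _ _ _ _ _
    (is_deriveD (is_derive_mul (is_derive_cst p x 1) Df) (is_derive_mul (is_derive_cst q x 1) Dg))).
  by rewrite !mul0r !add0r.
split.
  rewrite [X in is_derive _ _ X](_ : _ = (fun t => p * (t `^ nu * Z t) + q * (t `^ nu * V t))); last first.
    by apply/funext => t; ring.
  by apply: (@is_derive_eq _ _ _ _ _ _ _ _ (L _ _ _ _ Z2 V2)); ring.
rewrite [X in is_derive _ _ X](_ : _ = (fun t => p * (t `^ (1 - nu) * Z1 t) + q * (t `^ (1 - nu) * V1 t))); last first.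
  by apply/funext => t; ring.
by apply: (@is_derive_eq _ _ _ _ _ _ _ _ (L _ _ _ _ Z3 V3)); ring.
Qed.

Lemma cylinder_pair_ext nu (Z Z1 V V1 : R -> R) :
  Z =1 V -> Z1 =1 V1 -> cylinder_pair nu Z Z1 -> cylinder_pair nu V V1.
Proof. by move=> /funext -> /funext ->. Qed.

(** [Y_nu] combines [J_nu] and [J_(-nu)] with coefficients constant in [x]. The same combination of
    the companions [J_(nu-1)] and [- J_(1-nu)] is [Y_(nu-1)], because sine and cosine both change
    sign from [nu * pi] to [(nu-1) * pi]. *)
Lemma cylinder_pairY nu : sin (nu * pi) != 0 ->
  cylinder_pair nu (besselY nu) (besselY (nu - 1)).
Proof.
move=> s0.
have E x : (nu - 1) * x = nu * x - x by rewrite mulrBl mul1r.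
have sE : sin ((nu - 1) * pi) = - sin (nu * pi).
  by rewrite E sinB cospi sinpi mulr0 subr0 mulrN1.
have cE : cos ((nu - 1) * pi) = - cos (nu * pi).
  by rewrite E cosB cospi sinpi mulr0 addr0 mulrN1.
apply: cylinder_pair_ext (cylinder_pair_lin (cos (nu * pi) / sin (nu * pi)) (- (sin (nu * pi))^-1)
  (cylinder_pairJ nu) (cylinder_pairJN nu)) => x.
  by rewrite /besselY (negbTE s0) /besselY_quotient; field.
rewrite /besselY sE oppr_eq0 (negbTE s0) /besselY_quotient sE cE opprB.
by field.
Qed.

Lemma ge0_derive_le (f df : R -> R) :
  (forall x, 0 < x -> is_derive x 1 f (df x)) -> (forall x, 0 < x -> 0 <= df x) ->
  forall x y, 0 < x -> x <= y -> f x <= f y.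
Proof.
move=> D d0 x y x0 xy.
have pos t : t \in `[x, y] -> 0 < t by rewrite in_itv/= => /andP[/(lt_le_trans x0)].
have [||c cxy E] := @MVT_segment R f df x y xy.
- by move=> t /subset_itv_oo_cc /pos; exact: D.
- by apply: derivable_within_continuous => t /pos t0; exact: (@ex_derive _ _ _ _ _ _ _ (D t t0)).
by rewrite -subr_ge0 E mulr_ge0 ?subr_ge0// d0 ?pos.
Qed.

(** Splitting [x = x^nu x^(1-nu)] distributes the weight so that each factor has its derivative
    given by the pair relations; the product rule then cancels completely. *)
Lemma cylinder_wronskian nu (Z Z1 V V1 : R -> R) :
  cylinder_pair nu Z Z1 -> cylinder_pair nu V V1 ->
  forall x y, 0 < x -> 0 < y ->
  x * (Z x * V1 x - Z1 x * V x) = y * (Z y * V1 y - Z1 y * V y).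
Proof.
move=> HZ HV.
pose w x := (x `^ nu * Z x) * (x `^ (1 - nu) * V1 x) - (x `^ (1 - nu) * Z1 x) * (x `^ nu * V x).
have powE x : 0 < x -> x `^ nu * x `^ (1 - nu) = x.
  move=> x0; rewrite -powRD; last by rewrite (gt_eqF x0) implybT.
  by rewrite addrC subrK powRr1// ltW.
have wE x : 0 < x -> x * (Z x * V1 x - Z1 x * V x) = w x.
  by move=> x0; rewrite /w -{1}(powE _ x0); ring.
have Dw x : 0 < x -> is_derive x 1 w 0.
  move=> x0; have [Z2 Z3] := HZ x x0; have [V2 V3] := HV x x0.
  apply: (@is_derive_eq _ _ _ _ _ _ _ _ (is_deriveB (is_derive_mul Z2 V3) (is_derive_mul Z3 V2))).
  by ring.
have DNw x : 0 < x -> is_derive x 1 (fun t => - w t) 0.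
  by move=> /Dw H; apply: (@is_derive_eq _ _ _ _ _ _ _ _ (is_deriveN H)); rewrite oppr0.
have le x y : 0 < x -> 0 < y -> w x <= w y.
  move=> x0 y0; have [xy|/ltW yx] := leP x y.
    exact: (ge0_derive_le Dw).
  by rewrite -lerN2; exact: (ge0_derive_le DNw).
move=> x y x0 y0; rewrite !wE//.
by apply/le_anti; rewrite !le.
Qed.

(* The energy a^2 + b^2 of a := x^nu Z, b := x^nu Z1 is nondecreasing. *)
Lemma cylinder_lipschitz nu (Z Z1 : R -> R) X : 2^-1 <= nu -> 0 < X ->
  cylinder_pair nu Z Z1 -> Z1 X = 0 ->
  forall x y, 0 < x -> x <= y -> y <= X ->
  `|y `^ nu * Z y - x `^ nu * Z x| <= `|X `^ nu * Z X| * (y - x).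
Proof.
move=> nu2 X0 HZ ZX.
pose a t := t `^ nu * Z t; pose b t := t `^ nu * Z1 t.
have Da t : 0 < t -> is_derive t 1 a (b t) by move=> /HZ[].
have Db t : 0 < t -> is_derive t 1 b ((2 * nu - 1) / t * b t - a t).
  move=> t0; have [_ D3] := HZ t t0.
  (* The relation for [Z1] concerns [t^(1-nu) Z1]; the missing weight [t^(2 nu - 1)] produces the
     term [(2 nu - 1) / t], whose sign decides the monotonicity of the energy. *)
  apply: (@near_eq_is_derive R R^o R^o (fun t => t `^ (2 * nu - 1) * (t `^ (1 - nu) * Z1 t))).
    apply: filterS (near_gt0 t0) => u u0.
    rewrite mulrA -powRD; last by rewrite (gt_eqF u0) implybT.
    by rewrite (_ : 2 * nu - 1 + (1 - nu) = nu)//; ring.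
  apply: (@is_derive_eq _ _ _ _ _ _ _ _ (is_derive_mul (is_derive1_powR (2 * nu - 1) t0) D3)).
  rewrite (powR_sub1 _ t0) /a /b.
  rewrite (_ : t `^ nu = t `^ (2 * nu - 1) * t `^ (1 - nu)); last first.
    rewrite -powRD; last by rewrite (gt_eqF t0) implybT.
    by congr (_ `^ _); ring.
  by field; rewrite gt_eqF.
pose E t := a t * a t + b t * b t.
have DE t : 0 < t -> is_derive t 1 E (2 * ((2 * nu - 1) / t * b t ^+ 2)).
  move=> t0; apply: (@is_derive_eq _ _ _ _ _ _ _ _
    (is_deriveD (is_derive_mul (Da _ t0) (Da _ t0)) (is_derive_mul (Db _ t0) (Db _ t0)))).
  by ring.
have bX : b X = 0 by rewrite /b ZX mulr0.
(* As [b] vanishes at [X], the energy there is [a(X)^2], which bounds [b^2] on all of [(0, X]]. *)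
have bb t : 0 < t -> t <= X -> `|b t| <= `|a X|.
  move=> t0 tX.
  have : E t <= E X.
    apply: (ge0_derive_le DE) => // u u0.
    have nn : 0 <= 2 * nu - 1 by lra.
    by rewrite mulr_ge0// mulr_ge0 ?sqr_ge0// divr_ge0// ltW.
  rewrite /E bX mulr0 addr0 => H.
  rewrite -(@ler_pXn2r _ 2) ?nnegrE// -!normrX !ger0_norm ?sqr_ge0//.
  by rewrite !expr2 (le_trans _ H)// lerDr -expr2 sqr_ge0.
move=> x y x0 xy yX.
have pos t : t \in `[x, y] -> 0 < t by rewrite in_itv/= => /andP[/(lt_le_trans x0)].
have [||c cxy] := @MVT_segment R a b x y xy.
- by move=> t /subset_itv_oo_cc /pos; exact: Da.
- by apply: derivable_within_continuous => t /pos t0; exact: (@ex_derive _ _ _ _ _ _ _ (Da t t0)).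
rewrite -/(a y) -/(a x) => ->.
rewrite normrM (ger0_norm (_ : 0 <= y - x)) ?subr_ge0// ler_wpM2r ?subr_ge0//.
apply: bb; first exact: pos.
by move: cxy; rewrite in_itv/= => /andP[_ /le_trans]; apply.
Qed.

(** [F_mode] in the variable [s = eta_inf - eta], with the order detached from [nu_order] so that it
    can be perturbed. *)
Definition bessel_mode nu z s0 s : R :=
  s `^ nu * (pi * z * besselY (nu - 1) (z * s0) / (2 * s0 `^ (nu - 1)) * besselJ nu (z * s) +
             - (pi * z * besselJ (nu - 1) (z * s0) / (2 * s0 `^ (nu - 1))) * besselY nu (z * s)).

Definition wronskianJY nu : R :=
  besselJ nu 1 * besselY (nu - 1) 1 - besselJ (nu - 1) 1 * besselY nu 1.

Lemma bessel_mode_lipschitz_nonint nu z s0 : sin (nu * pi) != 0 -> 2^-1 <= nu ->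
  0 < z -> 0 < s0 -> forall s t, 0 < s -> s <= t -> t <= s0 ->
  `|bessel_mode nu z s0 t - bessel_mode nu z s0 s| <=
  `|pi / 2 * wronskianJY nu| * z * (t - s).
Proof.
move=> snu nu2 z0 s00 s t s0' st ts0.
set K1 := pi * z * besselY (nu - 1) (z * s0) / (2 * s0 `^ (nu - 1)).
set K2 := - (pi * z * besselJ (nu - 1) (z * s0) / (2 * s0 `^ (nu - 1))).
have HJ := cylinder_pairJ nu; have HY := cylinder_pairY snu.
have HZ := cylinder_pair_lin K1 K2 HJ HY.
set Z := (fun x => K1 * besselJ nu x + K2 * besselY nu x) in HZ.
set Z1 := (fun x => _ + _) in HZ.
(* The choice of [K1] and [K2] enters here: the companion, hence the derivative of the mode,
   vanishes at the initial point [s0]. *)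
have Z10 : Z1 (z * s0) = 0 by rewrite /Z1 /K1 /K2; ring.
(* In [x = z u] the mode is [z^(-nu)] times [x^nu Z(x)]; the increment [z (t - s)] of [x] is the
   source of the factor [z]. *)
have modeE u : 0 < u -> bessel_mode nu z s0 u = z `^ (- nu) * ((z * u) `^ nu * Z (z * u)).
  move=> u0; rewrite powRM ?ltW// powRN /bessel_mode -/K1 -/K2 -/(Z (z * u)).
  by field; rewrite gt_eqF// powR_gt0.
have zs : 0 < z * s0 by rewrite mulr_gt0.
have := @cylinder_lipschitz nu Z Z1 (z * s0) nu2 zs HZ Z10 (z * s) (z * t).
rewrite mulr_gt0// !ler_pM2l// => /(_ isT st ts0).
have t0 := lt_le_trans s0' st.
rewrite -mulrBr => H.
rewrite !modeE// -[in leLHS]mulrBr [in leLHS]normrM.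
have zn : 0 < z `^ (- nu) by rewrite powR_gt0.
rewrite (le_trans (ler_wpM2l (normr_ge0 _) H))// mulrA -normrM -modeE//.
rewrite mulrA ler_wpM2r ?subr_ge0// (ler_wpM2r (ltW z0))//.
rewrite /bessel_mode -/K1 -/K2.
(* The value of the mode at [s0] is [pi / 2] times the Wronskian expression at [x = z s0], the
   factor [x] coming from [z s0^nu / s0^(nu-1)]; constancy moves it to [x = 1]. *)
have := cylinder_wronskian HJ HY ltr01 zs; rewrite mul1r -/(wronskianJY nu) => ->.
rewrite le_eqVlt; apply/orP; left; apply/eqP; congr (`|_|).
rewrite /K1 /K2 (powR_sub1 _ s00); field.
by rewrite !gt_eqF// powR_gt0.
Qed.

End bessel_relations.

(** * Bessel functions and modes at integer order *)

Section integer_order.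
Context {R : realType}.
Implicit Types (mu nu x y s t a k : R) (n : nat).

Lemma dnbhs_shift a k : (fun x => x + k) @ a^' --> (a + k)^'.
Proof.
move=> A; rewrite /dnbhs /within /= => HA.
have : \forall x \near a, x + k != a + k -> A (x + k).
  have C : x + k @[x --> a] --> a + k by apply: cvgD; [exact: cvg_id|exact: cvg_cst].
  exact: C HA.
by apply: filterS => x H xa; apply: H; rewrite (inj_eq (addIr k)).
Qed.

Lemma cvg_difference_quotient (f : R -> R) a : derivable f a 1 ->
  (x - a)^-1 * (f x - f a) @[x --> a^'] --> 'D_1 f a.
Proof.
move=> D.
have S : x - a @[x --> a^'] --> (0 : R)^'.
  by have := @dnbhs_shift a (- a); rewrite subrr.
have D' : h^-1 *: (f (h%:A + a) - f a) @[h --> (0 : R)^'] --> 'D_1 f a := D.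
have := @cvg_comp _ _ _ _ _ _ _ _ S D'.
apply: cvg_trans; apply: near_eq_cvg.
by apply: nearW => x /=; rewrite [_%:A]mulr1 subrK.
Qed.

(** L'Hopital's rule through difference quotients: derivatives at the single point [a] suffice, and
    differentiability of [J] in the order has been established only at integers. *)
Lemma is_cvg_quotient_zeros (f g : R -> R) a :
  derivable f a 1 -> derivable g a 1 -> f a = 0 -> g a = 0 ->
  'D_1 g a != 0 -> cvg (f x / g x @[x --> a^']).
Proof.
move=> Df Dg fa ga g0.
have H : (x - a)^-1 * (f x - f a) / ((x - a)^-1 * (g x - g a)) @[x --> a^'] -->
    'D_1 f a / 'D_1 g a.
  apply: cvgM; first exact: cvg_difference_quotient.
  by apply: cvgV => //; exact: cvg_difference_quotient.
apply/cvg_ex; exists ('D_1 f a * ('D_1 g a)^-1).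
apply: cvg_trans H; apply: near_eq_cvg.
near=> x; rewrite fa ga !subr0.
have xa : x - a != 0.
  by rewrite subr_eq0; near: x; exact: nbhs_dnbhs_neq.
by rewrite invfM invrK mulrACA mulVf// mul1r.
Unshelve. all: by end_near. Qed.

Lemma cos_natpi n : cos (n%:R * pi) = (-1) ^+ n :> R.
Proof. by rewrite mulr_natl -[_ *+ _]add0r (alternatingn (@cosDpi R)) cos0 mulr1. Qed.

Lemma sin_natpi n : sin (n%:R * pi) = 0 :> R.
Proof. by rewrite mulr_natl -[_ *+ _]add0r (alternatingn (@sinDpi R)) sin0 mulr0. Qed.

Lemma sin_mulpi_eq0 nu : sin (nu * pi) = 0 -> exists m : int, nu = m%:~R.
Proof.
move=> s0; exists (Num.floor nu).
pose t := nu - (Num.floor nu)%:~R.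
have t0 : 0 <= t by rewrite subr_ge0 ge_floor.
have t1 : t < 1 by rewrite ltrBlDl -intrD1 floorD1_gt.
have st : sin (t * pi) = 0.
  have sm (m : int) : sin (m%:~R * pi) = 0 :> R.
    case: m => n; first exact: sin_natpi.
    by rewrite NegzE rmorphN/= mulNr sinN sin_natpi oppr0.
  by rewrite /t mulrBl sinB s0 sm mul0r mulr0 subr0.
apply/eqP; rewrite -subr_eq0 -/t; apply: contraT => tn0.
suff : 0 < sin (t * pi) by rewrite st ltxx.
have tp : 0 < t by rewrite lt_neqAle eq_sym tn0.
have p0 : 0 < pi :> R := pi_gt0 R.
apply: sin_gt0_pi; rewrite mulr_gt0//=.
by rewrite -[ltRHS]mul1r ltr_pM2r.
Qed.

Lemma derivable_besselJ_order (m : int) x : 0 < x ->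
  derivable (besselJ ^~ x) (m%:~R : R) 1.
Proof.
move=> x0; have x2 : 0 < x / 2 by rewrite divr_gt0.
rewrite [X in derivable X _ _](_ : _ = (fun mu => expR (mu * ln (x / 2)) * gser mu ((x / 2) ^+ 2))); last first.
  by apply/funext => mu; rewrite besselJE// /powR (gt_eqF x2).
apply: derivableM; last exact: derivable_gser_int.
have D := is_derive_mul (is_derive_id (m%:~R : R) 1) (is_derive_cst (ln (x / 2)) (m%:~R : R) 1).
exact: (@ex_derive _ _ _ _ _ _ _ (is_derive_comp (is_derive_expR _) D)).
Qed.

Lemma derivable_besselJ_oppr (m : int) x : 0 < x ->
  derivable (fun mu => besselJ (- mu) x) (m%:~R : R) 1.
Proof.
move=> x0.
have D := @derivable_besselJ_order (- m) x x0.
rewrite rmorphN/= in D.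
have D' := derivableP D.
exact: (@ex_derive _ _ _ _ _ _ _ (is_derive_comp D' (is_deriveNid (m%:~R : R) 1))).
Qed.

Lemma besselJN_nat n x : 0 < x -> besselJ (- n%:R) x = (-1) ^+ n * besselJ n%:R x.
Proof.
move=> x0; have x2 : 0 < x / 2 by rewrite divr_gt0.
rewrite !besselJE// gserN_nat powRN powR_mulrn ?ltW// (exprNn ((x / 2) ^+ 2)) exprAC.
have : (x / 2) ^+ n != 0 by rewrite expf_neq0// gt_eqF.
by move: ((x / 2) ^+ n) ((-1) ^+ n) (gser _ _) => p q g p0; field.
Qed.

(** At an integer [besselY] is a [lim], informative only once the limit exists. Numerator and
    denominator both vanish at [n], and the denominator has derivative [pi (-1)^n]. *)
Lemma cvg_besselY_quotient n x : 0 < x ->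
  besselY_quotient x mu @[mu --> (n%:R : R)^'] --> besselY n%:R x.
Proof.
move=> x0; rewrite /besselY sin_natpi eqxx.
have Dpi (f : R -> R) df a : is_derive (a * pi) 1 f df -> is_derive a 1 (fun t => f (t * pi)) (df * pi).
  move=> Df; apply: (@is_derive_comp R f (fun t => t * pi) _ _ _ Df).
  apply: (@is_derive_eq _ _ _ _ _ _ _ _ (is_derive_mul (is_derive_id a 1) (is_derive_cst (pi : R) a 1))).
  by rewrite /= mulr0 addr0 mul1r.
have Ds := Dpi _ _ n%:R (is_derive_sin (n%:R * pi)).
have Dc := Dpi _ _ n%:R (is_derive_cos (n%:R * pi)).
apply: (@is_cvg_quotient_zeros
  (fun mu => besselJ mu x * cos (mu * pi) - besselJ (- mu) x) (fun mu => sin (mu * pi))).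
- apply: derivableB; last exact: (@derivable_besselJ_oppr n).
  apply: derivableM; first exact: (@derivable_besselJ_order n).
  exact: (@ex_derive _ _ _ _ _ _ _ Dc).
- exact: (@ex_derive _ _ _ _ _ _ _ Ds).
- by rewrite cos_natpi besselJN_nat// mulrC subrr.
- exact: sin_natpi.
- by rewrite (@derive_val _ _ _ _ _ _ _ Ds) cos_natpi mulf_neq0 ?signr_eq0// gt_eqF// pi_gt0.
Qed.

Lemma near_sin_mulpi_neq0 n : \forall mu \near (n%:R : R)^', sin (mu * pi) != 0.
Proof.
have B : \forall mu \near (n%:R : R)^', `|n%:R - mu| < 1.
  by apply: cvg_within; exact: (@nbhsx_ballx R R^o n%:R 1 ltr01).
near=> mu; apply/eqP => /sin_mulpi_eq0[m E].
have mun : mu != n%:R by near: mu; exact: nbhs_dnbhs_neq.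
have : `|n%:R - mu| < 1 by near: mu; exact: B.
rewrite {}E in mun *.
rewrite (_ : n%:R - m%:~R = (n%:Z - m)%:~R); last by rewrite rmorphB.
rewrite -intr_norm ltrz1 ltr_norml => /andP[A A'].
have : m != n by apply: contra mun => /eqP ->.
by move: A A' => *; lia.
Unshelve. all: by end_near. Qed.

Lemma cvg_besselY n x : 0 < x ->
  besselY mu x @[mu --> (n%:R : R)^'] --> besselY n%:R x.
Proof.
move=> x0; apply: cvg_trans (@cvg_besselY_quotient n x x0); apply: near_eq_cvg.
have := near_sin_mulpi_neq0 n; apply: filterS => mu s0.
by rewrite /besselY (negbTE s0).
Qed.

Lemma cvg_besselJ n x : 0 < x ->
  besselJ mu x @[mu --> (n%:R : R)^'] --> besselJ n%:R x.
Proof.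
move=> x0; apply: cvg_within_filter.
have /derivable1_diffP/differentiable_continuous := @derivable_besselJ_order n x x0.
exact.
Qed.

Lemma cvg_dnbhs_pred (f : R -> R) n (l : R) : f mu @[mu --> (n%:R : R)^'] --> l ->
  f (mu - 1) @[mu --> (n.+1%:R : R)^'] --> l.
Proof.
move=> H; have := @dnbhs_shift n.+1%:R (-1).
rewrite (_ : n.+1%:R - 1 = n%:R); last by rewrite -natr1 addrK.
by move=> S; exact: (@cvg_comp _ _ _ (fun mu => mu - 1) f _ _ _ S H).
Qed.

(** The order tends to [n+1] so that the lower order [mu - 1] tends to the natural number [n], where
    convergence of [J] and [Y] is known. *)
Lemma cvg_bessel_mode n z s0 s : 0 < z -> 0 < s0 -> 0 < s ->
  bessel_mode mu z s0 s @[mu --> (n.+1%:R : R)^'] --> bessel_mode n.+1%:R z s0 s.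
Proof.
move=> z0 s00 s0'.
have zs0 : 0 < z * s0 by rewrite mulr_gt0.
have zs : 0 < z * s by rewrite mulr_gt0.
have Cp b : 0 < b -> b `^ mu @[mu --> (n.+1%:R : R)^'] --> b `^ n.+1%:R.
  move=> b0; apply: cvg_within_filter; rewrite /powR (gt_eqF b0).
  apply: continuous_cvg; first exact: continuous_expR.
  by apply: cvgMl; exact: cvg_id.
have Cp1 : s0 `^ (mu - 1) @[mu --> (n.+1%:R : R)^'] --> s0 `^ (n.+1%:R - 1).
  rewrite (powR_sub1 _ s00); under eq_fun do rewrite (powR_sub1 _ s00).
  by apply: cvgMl; exact: Cp.
have E : n.+1%:R - 1 = n%:R :> R by rewrite -natr1 addrK.
have C2 : 2 * s0 `^ (n.+1%:R - 1) != 0 by rewrite mulf_neq0// gt_eqF// powR_gt0.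
have CJ1 := cvg_dnbhs_pred (cvg_besselJ (n := n) zs0).
have CY1 := cvg_dnbhs_pred (cvg_besselY (n := n) zs0).
rewrite -E in CJ1 CY1.
rewrite /bessel_mode; apply: cvgM; first exact: Cp.
apply: cvgD; apply: cvgM; try exact: cvg_besselJ; try exact: cvg_besselY.
  apply: cvgM; first by apply: cvgMr; exact: CY1.
  by apply: cvgV => //; apply: cvgMr; exact: Cp1.
apply: cvgN; apply: cvgM; first by apply: cvgMr; exact: CJ1.
by apply: cvgV => //; apply: cvgMr; exact: Cp1.
Qed.

Lemma cvg_wronskianJY n :
  wronskianJY mu @[mu --> (n.+1%:R : R)^'] --> wronskianJY (n.+1%:R : R).
Proof.
have E : n.+1%:R - 1 = n%:R :> R by rewrite -natr1 addrK.
have CJ1 := cvg_dnbhs_pred (@cvg_besselJ n _ ltr01).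
have CY1 := cvg_dnbhs_pred (@cvg_besselY n _ ltr01).
rewrite -E in CJ1 CY1.
exact: (cvgB (cvgM (@cvg_besselJ n.+1 _ ltr01) CY1) (cvgM CJ1 (@cvg_besselY n.+1 _ ltr01))).
Qed.

Lemma bessel_mode_lipschitz nu z s0 : 1 < nu ->
  0 < z -> 0 < s0 -> forall s t, 0 < s -> s <= t -> t <= s0 ->
  `|bessel_mode nu z s0 t - bessel_mode nu z s0 s| <=
  `|pi / 2 * wronskianJY nu| * z * (t - s).
Proof.
move=> nu1 z0 s00 s t s0' st ts0.
have [|snu] := eqVneq (sin (nu * pi)) 0; last first.
  by apply: bessel_mode_lipschitz_nonint => //; lra.
move=> /sin_mulpi_eq0[m nuE].
(* An integer above 1 is at least 2, so nearby orders stay above [1/2] and the noninteger estimate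
   applies to them. *)
have [n nE] : exists n, nu = n.+2%:R.
  move: nu1; rewrite nuE ltr1z; case: m {nuE} => [[|[|n]]|n]//= _; by exists n.
rewrite {}nE => {nu nu1 m nuE}.
have t0 := lt_le_trans s0' st.
have A : `|bessel_mode mu z s0 t - bessel_mode mu z s0 s| @[mu --> (n.+2%:R : R)^'] -->
    `|bessel_mode n.+2%:R z s0 t - bessel_mode n.+2%:R z s0 s|.
  by apply: cvg_norm; apply: cvgB; exact: cvg_bessel_mode.
have B : `|pi / 2 * wronskianJY mu| * z * (t - s) @[mu --> (n.+2%:R : R)^'] -->
    `|pi / 2 * wronskianJY n.+2%:R| * z * (t - s).
  apply: cvgMl; apply: cvgMl; apply: cvg_norm; apply: cvgMr.
  exact: cvg_wronskianJY.
apply: (ler_cvg_to A B).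
near=> mu; apply: bessel_mode_lipschitz_nonint => //.
  by near: mu; exact: near_sin_mulpi_neq0.
apply: ltW; near: mu; apply: cvg_within; apply: lt_nbhsr.
by apply: (@lt_le_trans _ _ 1); [rewrite invf_lt1 ?ltr1n|rewrite ler1n].
Unshelve. all: by end_near. Qed.

(** Uniformity in [l] is the point: the Wronskian factor depends on [nu] only, and
    [z_l^2 = (c/r)^2 l (l+1)]. The mode [l = 0] is constant. *)
Lemma F_mode_lipschitz (c D r eta_inf : R) :
  0 < c -> 0 < D -> 0 < r -> 0 < eta_inf -> exists K, forall l eta h,
  0 <= eta < eta_inf -> 0 < h < eta_inf - eta ->
  (F_mode c D r eta_inf l (eta + h) - F_mode c D r eta_inf l eta) ^+ 2 <=
  K * (l * l.+1)%:R * h ^+ 2.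
Proof.
move=> c0 D0 r0 e0; set nu := nu_order c D eta_inf.
have nu1 : 1 < nu by rewrite /nu /nu_order ltrDr divr_gt0// ?mulr_gt0// ?exprn_gt0.
exists ((`|pi / 2 * wronskianJY nu| * (c / r)) ^+ 2) => l eta h /andP[eta0 etae] /andP[h0 he].
case: l => [|l]; first by rewrite /F_mode eqxx subrr expr0n/= mul0n mulr0 mul0r.
pose z := z_freq c r l.+1.
have z0 : 0 < z by rewrite /z /z_freq divr_gt0// mulr_gt0// sqrtr_gt0 ltr0n.
have FE u : F_mode c D r eta_inf l.+1 u = bessel_mode nu z eta_inf (eta_inf - u) by [].
rewrite !FE -real_normK ?num_real// distrC.
have H : `|bessel_mode nu z eta_inf (eta_inf - eta) - bessel_mode nu z eta_inf (eta_inf - (eta + h))| <=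
    `|pi / 2 * wronskianJY nu| * z * (eta_inf - eta - (eta_inf - (eta + h))).
  by apply: bessel_mode_lipschitz => //; lra.
rewrite -(@ler_pXn2r _ 2) ?nnegrE// in H; last first.
  by apply: mulr_ge0; [rewrite mulr_ge0// ltW|lra].
rewrite (le_trans H)// /z /z_freq.
rewrite (_ : eta_inf - eta - (eta_inf - (eta + h)) = h); last by ring.
rewrite !exprMn sqr_sqrtr//.
by rewrite le_eqVlt; apply/orP; left; apply/eqP; ring.
Qed.

End integer_order.

(** * Spherical harmonics *)

Section legendre_norm.
Context {R : realType}.
Implicit Types (p q : {poly R}) (l k n : nat) (t : R).

(** At [i = 0] the coefficient is a division by zero, hence 0; this fixes the constant of
    integration. *)
Definition antideriv p : {poly R} := \poly_(i < (size p).+1) (p`_i.-1 / i%:R).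

Lemma antiderivK p : (antideriv p)^`() = p.
Proof.
apply/polyP => i; rewrite coef_deriv coef_poly ltnS /=.
case: ltnP => [_|si]; last by rewrite mul0rn nth_default.
by rewrite -[LHS]mulr_natr divfK// pnatr_eq0.
Qed.

(* the integral of p over [-1, 1] *)
Definition polyint p : R := (antideriv p).[1] - (antideriv p).[-1].

Lemma deriv_inj_up_to_const p q : p^`() = q^`() -> p - q = (p`_0 - q`_0)%:P.
Proof.
move=> /polyP pq; apply/polyP => -[|i]; first by rewrite coefB coefC.
rewrite coefB coefC/=; have := pq i; rewrite !coef_deriv => /eqP.
by rewrite eqrMn2r//= => /eqP ->; rewrite subrr.
Qed.

Lemma polyint_deriv p : polyint p^`() = p.[1] - p.[-1].
Proof.
have /deriv_inj_up_to_const H := antiderivK p^`().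
rewrite /polyint (_ : antideriv _ = p + ((antideriv p^`())`_0 - p`_0)%:P); last first.
  by rewrite -H addrC subrK.
by rewrite !hornerD !hornerC; ring.
Qed.

Lemma polyintD p q : polyint (p + q) = polyint p + polyint q.
Proof.
rewrite -{1}(antiderivK p) -{1}(antiderivK q) -derivD polyint_deriv /polyint.
by rewrite !hornerD; ring.
Qed.

Lemma polyintZ (c : R) p : polyint (c *: p) = c * polyint p.
Proof.
by rewrite -{1}(antiderivK p) -derivZ polyint_deriv /polyint !hornerZ; ring.
Qed.

Lemma polyintN p : polyint (- p) = - polyint p.
Proof. by rewrite -scaleN1r polyintZ mulN1r. Qed.

Lemma polyint_by_parts p q : p.[1] * q.[1] = 0 -> p.[-1] * q.[-1] = 0 ->
  polyint (p^`() * q) = - polyint (p * q^`()).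
Proof.
move=> H1 H2; apply/eqP; rewrite -subr_eq0 opprK -polyintD -derivM.
by rewrite polyint_deriv !hornerM H1 H2 subrr.
Qed.

(** The substitution [x = cos t], which reduces colatitude integrals to algebra on polynomials. *)
Lemma integral_horner_cos p :
  (\int[lebesgue_measure]_(t in `[0%R, pi%R]) (p.[cos t] * sin t)%:E =
   (polyint p)%:E)%E.
Proof.
pose F t := - (antideriv p).[cos t].
have DF t : is_derive t 1 F (p.[cos t] * sin t).
  have D := is_derive_comp (is_derive_poly (antideriv p) (cos t)) (is_derive_cos t).
  apply: (@is_derive_eq _ _ _ _ _ _ _ _ (is_deriveN D)).
  by rewrite antiderivK; ring.
have cF t : F u @[u --> t] --> F t.
  apply: differentiable_continuous; apply/derivable1_diffP.
  exact: (@ex_derive _ _ _ _ _ _ _ (DF t)).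
rewrite (@continuous_FTC2 R _ F) ?pi_gt0//.
- by rewrite /F cospi cos0 -EFinB /polyint; congr (_%:E); ring.
- apply: continuous_subspaceT => t.
  apply: cvgM; last exact: continuous_sin.
  apply: continuous_comp; first exact: continuous_cos.
  exact: continuous_horner.
- split; first by move=> t _; exact: (@ex_derive _ _ _ _ _ _ _ (DF t)).
  + by apply: cvg_at_right_filter; exact: cF.
  + by apply: cvg_at_left_filter; exact: cF.
- by move=> t _; rewrite derive1E (@derive_val _ _ _ _ _ _ _ (DF t)).
Qed.

Lemma deriv_natr n : (n%:R : {poly R})^`() = 0.
Proof. by rewrite -polyC_natr derivC. Qed.

Let w l : {poly R} := ('X ^+ 2 - 1) ^+ l.

(** The relation [(X^2 - 1) w' = 2 l X w] for [w = (X^2 - 1)^l], differentiated [n+1] times. *)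
Lemma rodrigues_ode l n :
  ('X ^+ 2 - 1) * derivn n.+2 (w l) =
  ((l.*2)%:R - (n.+1.*2)%:R) * 'X * derivn n.+1 (w l) +
  n.+1%:R * ((l.*2)%:R - n%:R) * derivn n (w l).
Proof.
have d2 : ('X ^+ 2 - 1 : {poly R})^`() = 2%:R * 'X.
  by rewrite derivB derivXn -polyC1 derivC subr0 expr1 mulr_natl.
have w1 : ('X ^+ 2 - 1) * (w l)^`() = (l.*2)%:R * 'X * w l.
  case: l => [|l]; first by rewrite /w expr0 derivC mulr0 !mul0r.
  rewrite /w deriv_exp d2 -mulr_natr (exprS _ l) -mul2n natrM /=.
  by move: (('X ^+ 2 - 1) ^+ l) (l.+1%:R) => p q; ring.
move: ('X ^+ 2 - 1) d2 w1 => B d2 w1.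
elim: n => [|n IH].
  have := congr1 (@deriv R) w1.
  rewrite !derivM d2 derivX deriv_natr derivn0 => E.
  rewrite derivnS derivn1 (erefl : 1.*2 = 2)%N.
  move: E; move: ((l.*2)%:R) (w l) ((w l)^`()) ((w l)^`()^`()) => L v q p E.
  have -> : B * p = 2 * 'X * q + B * p - 2 * 'X * q by ring.
  by rewrite E; ring.
have D1 : (1 : {poly R})^`() = 0 by rewrite -polyC1 derivC.
have [T [T2 D2]] : exists T : {poly R}, T = 2 /\ T^`() = 0.
  by exists 2; split=> //; exact: deriv_natr 2.
move: IH; rewrite -!muln2 !natrM -[n.+1%:R]natr1 -[n.+2%:R]natr1 -[n.+1%:R]natr1.
rewrite -T2 in d2 *; rewrite !derivnS; move: (deriv_natr n) (deriv_natr l).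
move: (derivn n _) (n%:R) (l%:R) => a N L DN DL /(congr1 (@deriv R)).
rewrite !(derivM, derivD, derivN) d2 derivX DN DL D1 D2.
move: (a^`()) (a^`()^`()) (a^`()^`()^`()) => b c e E.
have -> : B * e = T * 'X * c + B * e - T * 'X * c by ring.
by rewrite E T2; ring.
Qed.

(** The associated Legendre equation in self-adjoint form; [derivn (l + k) (w l)] is proportional to
    the [k]-th derivative of the Legendre polynomial. *)
Lemma legendre_weight_deriv l k :
  ((1 - 'X ^+ 2) ^+ k.+1 * derivn (l + k).+1 (w l))^`() =
  - ((l%:R - k%:R) * (l + k).+1%:R) *: ((1 - 'X ^+ 2) ^+ k * derivn (l + k) (w l)).
Proof.
have d2 : (1 - 'X ^+ 2 : {poly R})^`() = - (2%:R * 'X).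
  by rewrite derivB derivXn -polyC1 derivC sub0r expr1 mulr_natl.
have := rodrigues_ode l (l + k).
rewrite derivM deriv_exp d2 -derivnS (exprS _ k) -(mulr_natr _ k.+1) /=.
rewrite -mul_polyC !(rmorphN, rmorphM, rmorphB)/= !polyC_natr.
rewrite -!mul2n !natrM -[(l + k).+1%:R]natr1 !natrD -[k.+1%:R]natr1.
move: (derivn (l + k) _) => a.
move: (a^`()) (a^`()^`()) => b c.
move: ((1 - _) ^+ k) (l%:R) (k%:R) => p L K E.
rewrite (_ : (1 - 'X ^+ 2) * p * c = - p * (('X ^+ 2 - 1) * c)); last by ring.
by rewrite E; ring.
Qed.

(** Up to the factor [(2^l l!)^2], the squared norm of the associated Legendre function on
    [[-1, 1]]. *)
Definition legendre_int l k : R :=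
  polyint ((1 - 'X ^+ 2) ^+ k * derivn (l + k) (w l) ^+ 2).

(** One integration by parts, without boundary terms because [(1 - X^2)^(k+1)] vanishes at the
    endpoints, then the self-adjoint equation. *)
Lemma legendre_int_rec l k :
  legendre_int l k.+1 = (l%:R - k%:R) * (l + k).+1%:R * legendre_int l k.
Proof.
rewrite /legendre_int addnS.
have b0 (x : R) : x ^+ 2 = 1 -> ((1 - 'X ^+ 2) ^+ k.+1).[x] = 0.
  by move=> x1; rewrite horner_exp !hornerE/= x1 subrr expr0n.
have E1 : ((1 - 'X ^+ 2) ^+ k.+1 : {poly R}).[1] = 0 by rewrite b0 ?expr1n.
have E2 : ((1 - 'X ^+ 2) ^+ k.+1 : {poly R}).[-1] = 0 by rewrite b0 ?sqrrN ?expr1n.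
rewrite expr2 mulrA mulrC {1}derivnS polyint_by_parts.
- rewrite legendre_weight_deriv -scalerAr scaleNr polyintN opprK polyintZ.
  by congr (_ * polyint _); rewrite mulrCA expr2.
- by rewrite hornerM E1 mul0r mulr0.
- by rewrite hornerM E2 mul0r mulr0.
Qed.

Lemma legendre_intE l k : (k <= l)%N ->
  legendre_int l k * (l - k)`!%:R = (l + k)`!%:R * legendre_int l 0.
Proof.
elim: k => [_|k IH kl]; first by rewrite addn0 subn0 mulrC.
have E : (l - k = (l - k.+1).+1)%N by rewrite -subnSK.
have := IH (ltnW kl); rewrite legendre_int_rec addnS factS natrM E factS natrM.
rewrite -E natrB ?(ltnW kl)// => H.
by rewrite -[RHS]mulrA -H; ring.
Qed.

Lemma derivn_w_factor l i : (i <= l)%N ->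
  exists q, derivn i (w l) = ('X ^+ 2 - 1) ^+ (l - i) * q.
Proof.
elim: i => [_|i IH il]; first by exists 1; rewrite derivn0 subn0 mulr1.
have [q E] := IH (ltnW il).
have Ei : (l - i = (l - i.+1).+1)%N by rewrite -subnSK.
exists (('X ^+ 2 - 1)^`() * (l - i)%:R * q + ('X ^+ 2 - 1) * q^`()).
rewrite derivnS E derivM deriv_exp Ei (exprS _ (l - i.+1)) /= -(mulr_natr _ (l - i.+1).+1).
move: ('X ^+ 2 - 1) => B; move: (B ^+ (l - i.+1)) (_%:R) (B^`()) (q^`()) => a b c d.
by ring.
Qed.

Lemma derivn_w_horner l i (x : R) : (i < l)%N -> x ^+ 2 = 1 -> (derivn i (w l)).[x] = 0.
Proof.
move=> il x1; have [q ->] := derivn_w_factor (ltnW il).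
by rewrite hornerM horner_exp !hornerE/= x1 subrr expr0n subn_eq0 leqNgt il mul0r.
Qed.

Lemma monic_w l : w l \is monic.
Proof. by apply: monic_exp; rewrite -polyC1; exact: monicXnsubC. Qed.

Lemma size_w l : size (w l) = l.*2.+1.
Proof.
have w0 : (0 < size (w l))%N by rewrite size_poly_gt0 monic_neq0// monic_w.
rewrite -(prednK w0) /w size_exp -polyC1 size_XnsubC//=.
by rewrite mul2n.
Qed.

Lemma derivn_w_top l : derivn l.*2 (w l) = ((l.*2)`!%:R)%:P.
Proof.
apply/polyP => i; rewrite coef_derivn coefC; case: i => [|i].
  rewrite addn0 ffactnn; have := monicP (monic_w l).
  by rewrite lead_coefE size_w/= => ->.
by rewrite nth_default ?mul0rn// size_w addnS ltnS leq_addr.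
Qed.

(** Integrating by parts [l] times moves all derivatives onto one factor, where [derivn l.*2 (w l)]
    is the constant [(2l)!]. The boundary terms vanish since fewer than [l] derivatives leave a
    factor [X^2 - 1]. *)
Lemma polyint_legendre_sqr l : legendre_int l 0 =
  (-1) ^+ l * (l.*2)`!%:R * polyint (w l).
Proof.
have H j : (j <= l)%N -> polyint (derivn (l - j) (w l) * derivn (l + j) (w l)) =
    (-1) ^+ j * legendre_int l 0.
  elim: j => [_|j IH jl].
    by rewrite expr0 mul1r /legendre_int subn0 addn0 expr0 mul1r expr2.
  have E : (l - j = (l - j.+1).+1)%N by rewrite -subnSK.
  have jl' : (l - j.+1 < l)%N by rewrite -E leq_subr.
  have := IH (ltnW jl); rewrite E derivnS polyint_by_parts.
  - by rewrite -derivnS addnS exprS -mulrA => <-; rewrite mulN1r opprK.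
  - by rewrite derivn_w_horner ?mul0r// expr1n.
  - by rewrite derivn_w_horner ?mul0r// sqrrN expr1n.
have := H l (leqnn l); rewrite subnn addnn derivn0 derivn_w_top mulrC mul_polyC polyintZ.
by move=> E; rewrite -mulrA E mulrA -expr2 sqrr_sign mul1r.
Qed.

(** A Beta integral, by induction: [X w_(l+1)] vanishes at both endpoints, so integrating its
    derivative gives [(2l+3) int w_(l+1) = - (2l+2) int w_l]. *)
Lemma polyint_w l :
  (-1) ^+ l * polyint (w l) * (l.*2.+1)`!%:R = 2 * (2 ^+ l * l`!%:R) ^+ 2.
Proof.
elim: l => [|l IH].
  rewrite /w !expr0 !mul1r mulr1 expr1n mulr1 -[1 : {poly R}](derivX R) polyint_deriv !hornerX.
  by rewrite opprK.
have D : ('X * w l.+1)^`() = (l.*2.+3)%:R *: w l.+1 + (l.+1.*2)%:R *: w l.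
  have d2 : ('X ^+ 2 - 1 : {poly R})^`() = 2%:R * 'X.
    by rewrite derivB derivXn -polyC1 derivC subr0 expr1 mulr_natl.
  have e2 : (l.+1.*2)%:R = 2%:R * l.+1%:R :> {poly R} by rewrite -mul2n natrM.
  have e3 : (l.*2.+3)%:R = 2%:R * l.+1%:R + 1 :> {poly R}.
    by rewrite -e2 natr1 doubleS.
  rewrite derivM derivX /w deriv_exp d2 (exprS _ l) -!mul_polyC !polyC_natr.
  rewrite -(mulr_natr _ l.+1) /= e2 e3.
  by move: (_ ^+ l) (l.+1%:R) => p L; ring.
have := polyint_deriv ('X * w l.+1); rewrite D polyintD !polyintZ !hornerM.
have h x : x ^+ 2 = 1 -> (w l.+1).[x] = 0.
  by move=> x1; apply: (@derivn_w_horner l.+1 0).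
rewrite (h 1) ?expr1n// (h (-1)) ?sqrrN ?expr1n// !mulr0 subrr => E.
have {}E : l.*2.+3%:R * polyint (w l.+1) = - (l.+1.*2%:R * polyint (w l)).
  by apply/eqP; rewrite -subr_eq0 opprK E.
rewrite doubleS factS natrM factS natrM.
transitivity ((-1) ^+ l.+1 * (l.*2.+3%:R * polyint (w l.+1)) * l.*2.+2%:R * (l.*2.+1)`!%:R); first by ring.
rewrite E.
transitivity (l.+1.*2%:R * l.*2.+2%:R * ((-1) ^+ l * polyint (w l) * (l.*2.+1)`!%:R)).
  by rewrite exprS; ring.
rewrite IH doubleS (exprS 2 l) (factS l) natrM (_ : l.*2.+2%:R = 2 * l.+1%:R); last by rewrite -doubleS -mul2n natrM.
by ring.
Qed.

Lemma legendre_int0 l :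
  legendre_int l 0 * l.*2.+1%:R = 2 * (2 ^+ l * l`!%:R) ^+ 2.
Proof.
by rewrite polyint_legendre_sqr -polyint_w factS natrM; ring.
Qed.

End legendre_norm.

Section complex_parts.
Context {R : realType}.
Implicit Types (z y : R[i]).

Definition sqnorm z : R := complex.Re z ^+ 2 + complex.Im z ^+ 2.

Lemma ReM z y : complex.Re (z * y) =
  complex.Re z * complex.Re y - complex.Im z * complex.Im y.
Proof. by case: z => a b; case: y => p q. Qed.

Lemma ImM z y : complex.Im (z * y) =
  complex.Re z * complex.Im y + complex.Im z * complex.Re y.
Proof. by case: z => a b; case: y => p q. Qed.

Lemma Re_conj z : complex.Re z^*%C = complex.Re z.
Proof. by case: z. Qed.

Lemma Im_conj z : complex.Im z^*%C = - complex.Im z.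
Proof. by case: z. Qed.

Lemma Re_sum I (s : seq I) (Q : pred I) (F : I -> R[i]) :
  complex.Re (\sum_(i <- s | Q i) F i) = \sum_(i <- s | Q i) complex.Re (F i).
Proof. by apply: (big_morph (@complex.Re R)) => // -[a b] [p q]. Qed.

Lemma Im_sum I (s : seq I) (Q : pred I) (F : I -> R[i]) :
  complex.Im (\sum_(i <- s | Q i) F i) = \sum_(i <- s | Q i) complex.Im (F i).
Proof. by apply: (big_morph (@complex.Im R)) => // -[a b] [p q]. Qed.

Lemma sqnormM z y : sqnorm (z * y) = sqnorm z * sqnorm y.
Proof. by rewrite /sqnorm ReM ImM; ring. Qed.

Lemma sqnorm_real (x : R) : sqnorm (x%:C)%C = x ^+ 2.
Proof. by rewrite /sqnorm /= expr0n addr0. Qed.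

Lemma sqnorm_sum (I : finType) (F : I -> R[i]) :
  sqnorm (\sum_i F i) = \sum_i \sum_j complex.Re (F i * (F j)^*%C).
Proof.
rewrite /sqnorm Re_sum Im_sum !expr2 !big_distrlr -big_split/=.
apply: eq_bigr => i _; rewrite -big_split; apply: eq_bigr => j _.
by rewrite ReM Re_conj Im_conj mulrN opprK.
Qed.

Lemma sqnorm_normc z : complex.ComplexField.Normc.normc z ^+ 2 = sqnorm z.
Proof.
by case: z => a b /=; rewrite sqr_sqrtr// addr_ge0 ?sqr_ge0.
Qed.

End complex_parts.

(** * Second moments of combinations of uncorrelated variables *)

Section uncorrelated.
Context {R : realType} {d : measure_display} {W : measurableType d}.
Variable P : probability W R.

(** Integrability has to be extracted first: a finite expectation does not guarantee it for an
    integrand of varying sign. The diagonal terms [|b_i|^2] are nonnegative, hence integrable, and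
    [|b_i|^2 + |b_j|^2] dominates the mixed ones. *)
Lemma uncorrelated_sqnorm (I : finType) (b : I -> W -> R[i]) (C : I -> R)
    (z : I -> R[i]) :
  (forall i, measurable_fun setT (fun w => complex.Re (b i w))) ->
  (forall i, measurable_fun setT (fun w => complex.Im (b i w))) ->
  (forall i j, complex_expectation P (fun w => b i w * (b j w)^*%C)
     (if i == j then (C i)%:C%C else 0)) ->
  (\int[P]_w (sqnorm (\sum_i z i * b i w))%:E =
   (\sum_i sqnorm (z i) * C i)%:E)%E.
Proof.
move=> mR mI E.
pose A i j w := complex.Re (b i w * (b j w)^*%C).
pose B i j w := complex.Im (b i w * (b j w)^*%C).
have AE i j w : A i j w = complex.Re (b i w) * complex.Re (b j w) + complex.Im (b i w) * complex.Im (b j w).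
  by rewrite /A ReM Re_conj Im_conj mulrN opprK.
have BE i j w : B i j w = complex.Im (b i w) * complex.Re (b j w) - complex.Re (b i w) * complex.Im (b j w).
  by rewrite /B ImM Re_conj Im_conj mulrN addrC.
have mA i j : measurable_fun setT (A i j).
  rewrite (_ : A i j = fun w => complex.Re (b i w) * complex.Re (b j w) + complex.Im (b i w) * complex.Im (b j w)); last exact/funext.
  by apply: measurable_funD; apply: measurable_funM.
have mB i j : measurable_fun setT (B i j).
  rewrite (_ : B i j = fun w => complex.Im (b i w) * complex.Re (b j w) - complex.Re (b i w) * complex.Im (b j w)); last exact/funext.
  by apply: measurable_funB; apply: measurable_funM.
have EA i j : (\int[P]_w (A i j w)%:E = (if i == j then C i else 0)%:E)%E.
  by have [] := E i j; rewrite unlock; case: ifP.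
have EB i j : (\int[P]_w (B i j w)%:E = 0)%E.
  by have [_] := E i j; rewrite unlock; case: ifP.
have iD i : P.-integrable setT (EFin \o A i i).
  apply/integrableP; split; first exact/measurable_EFinP.
  rewrite (_ : (\int[P]_w `|(EFin \o A i i) w|)%E = (C i)%:E) ?ltry//.
  have := EA i i; rewrite eqxx => <-; apply: eq_integral => w _ /=.
  by rewrite ger0_norm// AE -!expr2 addr_ge0 ?sqr_ge0.
have iS i j : P.-integrable setT (EFin \o (fun w => A i i w + A j j w)).
  by rewrite (_ : _ \o _ = (EFin \o A i i) \+ (EFin \o A j j))%E//; exact: integrableD.
have bnd (p q u v : R) : `|p * u + q * v| <= `|p * p + q * q + (u * u + v * v)|.
  rewrite [leRHS]ger0_norm; last by rewrite !addr_ge0 // -expr2 sqr_ge0.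
  have := sqr_ge0 (p + u); have := sqr_ge0 (p - u); have := sqr_ge0 (q + v); have := sqr_ge0 (q - v).
  have := sqr_ge0 p; have := sqr_ge0 q; have := sqr_ge0 u; have := sqr_ge0 v.
  by rewrite ler_norml !expr2 => *; apply/andP; split; lra.
have iA i j : P.-integrable setT (EFin \o A i j).
  apply: (@le_integrable _ _ _ P setT measurableT _ _ _ _ (iS i j)); first exact/measurable_EFinP.
  by move=> w _ /=; rewrite lee_fin !AE; exact: bnd.
have iB i j : P.-integrable setT (EFin \o B i j).
  apply: (@le_integrable _ _ _ P setT measurableT _ _ _ _ (iS i j)); first exact/measurable_EFinP.
  move=> w _ /=; rewrite lee_fin BE !AE -mulNr.
  have := bnd (complex.Im (b i w)) (- complex.Re (b i w)) (complex.Re (b j w)) (complex.Im (b j w)).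
  by rewrite mulrNN [complex.Im (b i w) * complex.Im (b i w) + _]addrC.
pose p i j : R := complex.Re (z i * (z j)^*%C).
pose q i j : R := complex.Im (z i * (z j)^*%C).
pose h i j w := ((p i j)%:E * (A i j w)%:E + (- q i j)%:E * (B i j w)%:E)%E.
have ih i j : P.-integrable setT (h i j).
  by apply: integrableD => //; apply: integrableZl => //; [exact: iA|exact: iB].
have Eh i j : (\int[P]_w h i j w = (p i j * (if i == j then C i else 0))%:E)%E.
  rewrite integralD//; [|by apply: integrableZl => //; exact: iA|by apply: integrableZl => //; exact: iB].
  rewrite integralZl//; last exact: iA.
  rewrite integralZl//; last exact: iB.
  by rewrite EA EB mule0 adde0 EFinM.
transitivity (\int[P]_w (\sum_i \sum_j h i j w))%E.
  apply: eq_integral => w _; rewrite sqnorm_sum -sumEFin; apply: eq_bigr => i _.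
  rewrite -sumEFin; apply: eq_bigr => j _; rewrite /h -!EFinM -EFinD; congr (_%:E).
  rewrite /p /q /A /B !(ReM, ImM, Re_conj, Im_conj); ring.
rewrite integral_sum//; last by move=> i; apply: integrable_sum => // j _; exact: ih.
rewrite -sumEFin; apply: eq_bigr => i _.
rewrite integral_sum// (bigD1 i)//= Eh eqxx big1 ?adde0.
  by congr (_%:E); rewrite /p ReM Re_conj Im_conj /sqnorm; ring.
by move=> j ji; rewrite Eh eq_sym (negbTE ji) mulr0.
Qed.

End uncorrelated.

Section spherical_harmonic_norm.
Context {R : realType}.
Implicit Types (l k : nat) (t f : R) (m : int).

(** [|Y_lm|^2] with [|m| = k], as a polynomial in [cos t]: squaring removes the square root and the
    modulus removes the longitude. *)
Definition legendre_sqr_poly l k : {poly R} :=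
  ((l.*2.+1)%:R / (4 * pi) * ((l - k)`!%:R / (l + k)`!%:R) / (2 ^+ l * l`!%:R) ^+ 2) *:
  ((1 - 'X ^+ 2) ^+ k * derivn (l + k) (('X ^+ 2 - 1) ^+ l) ^+ 2).

(** The normalization of [Y_lm]; the complementary factor [2 pi] is the length of the longitude
    interval. *)
Lemma polyint_legendre_sqr_poly l k : (k <= l)%N ->
  polyint (legendre_sqr_poly l k) = (2 * pi)^-1.
Proof.
move=> kl; rewrite polyintZ -[polyint _]/(legendre_int l k).
have a0 : (l - k)`!%:R != 0 :> R by rewrite pnatr_eq0 -lt0n fact_gt0.
have b0 : (l + k)`!%:R != 0 :> R by rewrite pnatr_eq0 -lt0n fact_gt0.
have c0 : l.*2.+1%:R != 0 :> R by rewrite pnatr_eq0.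
have e0 : (2 ^+ l * l`!%:R) ^+ 2 != 0 :> R.
  by rewrite expf_neq0// mulf_neq0 ?expf_neq0 ?pnatr_eq0// -lt0n fact_gt0.
have p0 : pi != 0 :> R by rewrite gt_eqF// pi_gt0.
have := @legendre_intE R l k kl; move/(canRL (mulfK a0)) => ->.
have := @legendre_int0 R l; move/(canRL (mulfK c0)) => ->.
move: ((l - k)`!%:R) ((l + k)`!%:R) (l.*2.+1%:R) ((2 ^+ l * l`!%:R) ^+ 2) a0 b0 c0 e0 => u v x y u0 v0 x0 y0.
by move: (pi : R) p0 => p p0; field; rewrite u0 v0 x0 y0 p0.
Qed.

Lemma sqnorm_sph_harm_nneg l k t f :
  sqnorm (sph_harm_nneg l k t f) = (legendre_sqr_poly l k).[cos t].
Proof.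
rewrite /sph_harm_nneg sqnormM sqnorm_real [sqnorm (_ +i* _)%C]cos2Dsin2 mulr1.
have p0 : 0 <= (4 * pi)^-1 :> R by rewrite invr_ge0 mulr_ge0 ?pi_ge0.
rewrite exprMn sqr_sqrtr ?mulr_ge0//.
rewrite /assoc_legendre /legendre_sqr_poly hornerZ hornerM !horner_exp.
rewrite (_ : (1 - 'X ^+ 2).[cos t] = 1 - cos t ^+ 2); last by rewrite !hornerE.
have E1 : ((-1) ^+ k : R) ^+ 2 = 1 := sqrr_sign R k.
have E2 : (Num.sqrt (1 - cos t ^+ 2) ^+ k) ^+ 2 = (1 - cos t ^+ 2) ^+ k.
  by rewrite exprAC sqr_sqrtr// -sin2cos2 sqr_ge0.
rewrite [in LHS]exprMn [in LHS]exprMn E2 [in LHS]exprMn E1 mul1r exprVn.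
by rewrite -!mulrA.
Qed.

Lemma sqnorm_sph_harm l m t f :
  sqnorm (sph_harm l m t f) = (legendre_sqr_poly l `|m|%N).[cos t].
Proof.
case: m => k; first exact: sqnorm_sph_harm_nneg.
rewrite /sph_harm sqnormM (_ : sqnorm (_ ^+ _) = 1) ?mul1r; last first.
  elim: k.+1 => [|j IH]; first by rewrite expr0 (sqnorm_real 1) expr1n.
  by rewrite exprS sqnormM IH mulr1 /sqnorm /= oppr0 expr0n addr0 sqrrN expr1n.
rewrite -(sqnorm_sph_harm_nneg _ _ _ f).
by rewrite /sqnorm Re_conj Im_conj sqrrN.
Qed.

End spherical_harmonic_norm.

(** * The norm of L^2(Omega x S^2) *)

Section complex_measurability.
Context {R : realType} {d : measure_display} {T : measurableType d}.
Implicit Types (Z Y : T -> R[i]).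

Definition complex_measurable Z :=
  measurable_fun setT (fun x => complex.Re (Z x)) /\
  measurable_fun setT (fun x => complex.Im (Z x)).

Lemma complex_measurable_cst (z : R[i]) : complex_measurable (fun=> z).
Proof. by split; exact: measurable_cst. Qed.

Lemma complex_measurableM Z Y : complex_measurable Z -> complex_measurable Y ->
  complex_measurable (fun x => Z x * Y x).
Proof.
move=> [Z1 Z2] [Y1 Y2]; split.
  rewrite (_ : (fun _ => _) = fun x => complex.Re (Z x) * complex.Re (Y x) - complex.Im (Z x) * complex.Im (Y x)).
    by apply: measurable_funB; exact: measurable_funM.
  by apply/funext => x; rewrite ReM.
rewrite (_ : (fun _ => _) = fun x => complex.Re (Z x) * complex.Im (Y x) + complex.Im (Z x) * complex.Re (Y x)).
  by apply: measurable_funD; exact: measurable_funM.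
by apply/funext => x; rewrite ImM.
Qed.

Lemma complex_measurable_conj Z : complex_measurable Z ->
  complex_measurable (fun x => (Z x)^*%C).
Proof.
move=> [Z1 Z2]; split.
  by rewrite (_ : (fun _ => _) = fun x => complex.Re (Z x))//; apply/funext => x; rewrite Re_conj.
rewrite (_ : (fun _ => _) = \- (fun x => complex.Im (Z x))); first exact: measurable_funN.
by apply/funext => x; rewrite Im_conj.
Qed.

Lemma complex_measurable_sum (I : Type) (s : seq I) (F : I -> T -> R[i]) :
  (forall i, complex_measurable (F i)) ->
  complex_measurable (fun x => \sum_(i <- s) F i x).
Proof.
move=> H; split.
  rewrite (_ : (fun _ => _) = fun x => \sum_(i <- s) complex.Re (F i x)).
    by apply: measurable_sum => i; exact: (H i).1.
  by apply/funext => x; rewrite Re_sum.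
rewrite (_ : (fun _ => _) = fun x => \sum_(i <- s) complex.Im (F i x)).
  by apply: measurable_sum => i; exact: (H i).2.
by apply/funext => x; rewrite Im_sum.
Qed.

Lemma complex_measurable_sqnorm Z : complex_measurable Z ->
  measurable_fun setT (fun x => sqnorm (Z x)).
Proof. by move=> [Z1 Z2]; apply: measurable_funD; exact: measurable_funX. Qed.

End complex_measurability.

Lemma complex_measurable_comp {R : realType} {d d' : measure_display}
    {T : measurableType d} {U : measurableType d'} (Z : U -> R[i]) (g : T -> U) :
  measurable_fun setT g -> complex_measurable Z -> complex_measurable (fun x => Z (g x)).
Proof.
move=> mg [Z1 Z2]; split.
  exact: (measurableT_comp Z1 mg).
exact: (measurableT_comp Z2 mg).
Qed.

Section spherical_harmonic_measurability.
Context {R : realType}.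

Lemma measurable_assoc_legendre_cos (l k : nat) :
  measurable_fun setT (fun t : R => assoc_legendre l k (cos t)).
Proof.
apply: continuous_measurable_fun => t.
have Cc : {for t, continuous (@cos R)} by exact: continuous_cos.
apply: cvgM; last by apply: continuous_comp => //; exact: continuous_horner.
apply: cvgMr; apply: (@continuous_comp _ _ _ (fun t : R => Num.sqrt (1 - cos t ^+ 2)) (fun x => x ^+ k)).
  apply: (@continuous_comp _ _ _ (fun t : R => 1 - cos t ^+ 2)); last exact: sqrt_continuous.
  apply: cvgB; first exact: cvg_cst.
  by apply: (@continuous_comp _ _ _ cos (fun x => x ^+ 2)) => //; exact: exprn_continuous.
exact: exprn_continuous.
Qed.

Lemma complex_measurable_sph_harm (l : nat) (m : int) :
  complex_measurable (fun q : R * R => sph_harm l m q.1 q.2).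
Proof.
have nneg k : complex_measurable (fun q : R * R => sph_harm_nneg l k q.1 q.2).
  apply: complex_measurableM; split => /=.
  - apply: measurable_funM; first exact: measurable_cst.
    exact: (measurableT_comp (measurable_assoc_legendre_cos l k) measurable_fst).
  - exact: measurable_cst.
  - apply: (@measurableT_comp _ _ _ _ _ _ (@cos R)); first exact: continuous_measurable_fun (@continuous_cos R).
    by apply: measurable_funM; [exact: measurable_cst|exact: measurable_snd].
  - apply: (@measurableT_comp _ _ _ _ _ _ (@sin R)); first exact: continuous_measurable_fun (@continuous_sin R).
    by apply: measurable_funM; [exact: measurable_cst|exact: measurable_snd].
case: m => k; first exact: nneg.
apply: complex_measurableM; first exact: complex_measurable_cst.
exact: complex_measurable_conj.
Qed.

End spherical_harmonic_measurability.

(** * Threefold iterated integrals of nonnegative functions *)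

Section iterated_integral.
Context {R : realType} {d1 d2 d3 : measure_display} {T1 : measurableType d1}
  {T2 : measurableType d2} {T3 : measurableType d3}.
Variables (m1 : {sigma_finite_measure set T1 -> \bar R})
  (m2 : {sigma_finite_measure set T2 -> \bar R})
  (m3 : {sigma_finite_measure set T3 -> \bar R}).
Implicit Types f g : T1 * (T2 * T3) -> \bar R.

Definition integral3 f : \bar R :=
  (\int[m1]_x \int[m2]_y \int[m3]_z f (x, (y, z)))%E.

Let inner f (q : T1 * T2) : \bar R := (\int[m3]_z f (q.1, (q.2, z)))%E.

Let measurable_section f x y : measurable_fun setT f ->
  measurable_fun setT (fun z => f (x, (y, z))).
Proof.
move=> mf; apply: measurableT_comp => //.
by apply: measurable_fun_pair => //; exact: measurable_fun_pair.
Qed.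

Let measurable_inner f : measurable_fun setT f -> (forall p, 0 <= f p)%E ->
  measurable_fun setT (inner f).
Proof.
move=> mf f0.
apply: (measurable_fun_fubini_tonelli_F (m2 := m3)
  (fun q : (T1 * T2) * T3 => f (q.1.1, (q.1.2, q.2)))) => //.
apply: measurableT_comp => //; apply: measurable_fun_pair.
  exact: (measurableT_comp measurable_fst measurable_fst).
apply: measurable_fun_pair; last exact: measurable_snd.
exact: (measurableT_comp measurable_snd measurable_fst).
Qed.

Let inner_ge0 f q : (forall p, 0 <= f p)%E -> (0 <= inner f q)%E.
Proof. by move=> f0; apply: integral_ge0. Qed.

Let measurable_inner2 f x : measurable_fun setT f -> (forall p, 0 <= f p)%E ->
  measurable_fun setT (fun y => inner f (x, y)).
Proof.
move=> mf f0; apply: measurableT_comp; first exact: measurable_inner.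
exact: measurable_fun_pair.
Qed.

Let measurable_outer f : measurable_fun setT f -> (forall p, 0 <= f p)%E ->
  measurable_fun setT (fun x => \int[m2]_y inner f (x, y))%E.
Proof.
move=> mf f0; apply: (measurable_fun_fubini_tonelli_F (m2 := m2) (inner f)).
  exact: measurable_inner.
by move=> q; exact: inner_ge0.
Qed.

(** Tonelli used twice brings the expectation innermost, where the covariances can be used at a
    fixed point of the sphere. *)
Lemma integral3_swap f : measurable_fun setT f -> (forall p, 0 <= f p)%E ->
  integral3 f = (\int[m2]_y \int[m3]_z \int[m1]_x f (x, (y, z)))%E.
Proof.
move=> mf f0; rewrite /integral3.
rewrite (fubini_tonelli (m1 := m1) (m2 := m2) (inner f)); last first.
- by move=> q; exact: inner_ge0.
- exact: measurable_inner.
apply: eq_integral => y _.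
rewrite -(fubini_tonelli (m1 := m1) (m2 := m3) (fun q => f (q.1, (y, q.2))))//.
apply: measurableT_comp => //; apply: measurable_fun_pair; first exact: measurable_fst.
by apply: measurable_fun_pair => //; exact: measurable_snd.
Qed.

Lemma integral3_le f g : measurable_fun setT f -> measurable_fun setT g ->
  (forall p, 0 <= f p)%E -> (forall p, f p <= g p)%E ->
  (integral3 f <= integral3 g)%E.
Proof.
move=> mf mg f0 fg.
have g0 p : (0 <= g p)%E by exact: le_trans (f0 p) (fg p).
apply: ge0_le_integral => //; [|exact: (measurable_outer mf f0)|exact: (measurable_outer mg g0)|].
  by move=> x _; apply: integral_ge0 => y _; apply: integral_ge0.
move=> x _; apply: ge0_le_integral => //; [|exact: (measurable_inner2 x mf f0)|exact: (measurable_inner2 x mg g0)|].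
  by move=> y _; apply: integral_ge0.
by move=> y _; apply: ge0_le_integral => //; exact: measurable_section.
Qed.

Lemma integral3D f g : measurable_fun setT f -> measurable_fun setT g ->
  (forall p, 0 <= f p)%E -> (forall p, 0 <= g p)%E ->
  integral3 (fun p => f p + g p)%E = (integral3 f + integral3 g)%E.
Proof.
move=> mf mg f0 g0; rewrite /integral3.
rewrite -ge0_integralD//; first last.
- exact: (measurable_outer mg g0).
- by move=> x _; apply: integral_ge0 => y _; apply: integral_ge0.
- exact: (measurable_outer mf f0).
- by move=> x _; apply: integral_ge0 => y _; apply: integral_ge0.
apply: eq_integral => x _; rewrite -ge0_integralD//; first last.
- exact: (measurable_inner2 x mg g0).
- by move=> y _; apply: integral_ge0.
- exact: (measurable_inner2 x mf f0).
- by move=> y _; apply: integral_ge0.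
by apply: eq_integral => y _; rewrite -ge0_integralD//; exact: measurable_section.
Qed.

Lemma integral3Zl (k : R) f : measurable_fun setT f -> (forall p, 0 <= f p)%E ->
  0 <= k -> integral3 (fun p => k%:E * f p)%E = (k%:E * integral3 f)%E.
Proof.
move=> mf f0 k0; rewrite /integral3.
rewrite -ge0_integralZl//; first last.
- by move=> x _; apply: integral_ge0 => y _; apply: integral_ge0.
- exact: (measurable_outer mf f0).
apply: eq_integral => x _; rewrite -ge0_integralZl//; first last.
- by move=> y _; apply: integral_ge0.
- exact: (measurable_inner2 x mf f0).
by apply: eq_integral => y _; rewrite -ge0_integralZl//; exact: measurable_section.
Qed.

End iterated_integral.

Section L2_sphere.
Context {R : realType} {d : measure_display} {W : measurableType d}.
Variable P : probability W R.
Implicit Types (X Y : R -> R -> W -> R).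
Local Notation mu := (@lebesgue_measure R).
Local Notation int3 := (integral3 P mu mu).

Definition sph_dom : set (R * R) := `[0, pi] `*` `[0, 2 * pi].

Definition L2sq X : \bar R :=
  (\int[P]_w \int[mu]_(t in `[0%R, pi%R]) \int[mu]_(f in `[0%R, (2 * pi)%R])
     ((X t f w ^+ 2 * sin t)%R)%:E)%E.

Lemma L2normE X : L2norm P X = poweR (L2sq X) 2^-1.
Proof. by []. Qed.

(** Extension by zero makes all three integrals range over whole spaces; nonnegativity then holds
    everywhere, as [sin] is nonnegative on [[0, pi]]. *)
Definition L2density X : W * (R * R) -> \bar R :=
  (fun p => ((X p.2.1 p.2.2 p.1 ^+ 2 * sin p.2.1)%R)%:E) \_ ([set: W] `*` sph_dom).

(** Stated for the square because the square of a modulus [normc] is a polynomial in the real and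
    imaginary parts. *)
Definition sqr_measurable X :=
  measurable_fun ([set: W] `*` sph_dom) (fun p => X p.2.1 p.2.2 p.1 ^+ 2).

Lemma measurable_sph_dom : measurable sph_dom.
Proof. by apply: measurableX; exact: measurable_itv. Qed.

Lemma measurable_full_dom : measurable ([set: W] `*` sph_dom).
Proof. by apply: measurableX => //; exact: measurable_sph_dom. Qed.

Lemma L2density_ge0 X p : (0 <= L2density X p)%E.
Proof.
rewrite /L2density patchE; case: ifPn => // /set_mem[_ [/= + _]].
by rewrite in_itv/= => ?; rewrite lee_fin mulr_ge0 ?sqr_ge0// sin_ge0_pi.
Qed.

Lemma measurable_sin_colatitude : measurable_fun setT (fun p : W * (R * R) => sin p.2.1).
Proof.
apply: (@measurableT_comp _ _ _ _ _ _ (@sin R)); first exact: continuous_measurable_fun (@continuous_sin R).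
exact: (measurableT_comp measurable_fst measurable_snd).
Qed.

Lemma measurable_L2density X : sqr_measurable X -> measurable_fun setT (L2density X).
Proof.
move=> mX; apply/measurable_restrict => //; first exact: measurable_full_dom.
rewrite setTI; apply/measurable_EFinP; apply: measurable_funM => //.
by apply: measurable_funTS; exact: measurable_sin_colatitude.
Qed.

Lemma L2sqE X : L2sq X = int3 (L2density X).
Proof.
apply: eq_integral => w _.
rewrite integral_mkcond; apply: eq_integral => t _; rewrite patchE.
case: ifPn => [tI|tI]; last first.
  rewrite integral0_eq// => f _; rewrite /L2density patchE ifN//.
  by apply: contra tI => /set_mem[_ [/= + _]] => ?; exact/mem_set.
rewrite integral_mkcond; apply: eq_integral => f _; rewrite patchE /L2density patchE.
case: ifPn => fI.
  by rewrite ifT//; apply/mem_set; split => //; split; exact/set_mem.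
by rewrite ifN//; apply: contra fI => /set_mem[_ [/= _ +]] => ?; exact/mem_set.
Qed.

Lemma L2sq_le3 X X1 X2 X3 : sqr_measurable X -> sqr_measurable X1 ->
  sqr_measurable X2 -> sqr_measurable X3 ->
  (forall t f w, X t f w ^+ 2 <= 3 * (X1 t f w ^+ 2 + X2 t f w ^+ 2 + X3 t f w ^+ 2)) ->
  (L2sq X <= 3%:E * (L2sq X1 + L2sq X2 + L2sq X3))%E.
Proof.
move=> mX m1 m2 m3 H; rewrite !L2sqE.
have M Y : sqr_measurable Y -> measurable_fun setT (L2density Y) by exact: measurable_L2density.
have G Y p : (0 <= L2density Y p)%E by exact: L2density_ge0.
have M12 : measurable_fun setT (fun p => L2density X1 p + L2density X2 p)%E.
  by apply: emeasurable_funD; exact: M.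
have M123 : measurable_fun setT (fun p => L2density X1 p + L2density X2 p + L2density X3 p)%E.
  by apply: emeasurable_funD => //; exact: M.
have G12 p : (0 <= L2density X1 p + L2density X2 p)%E by exact: adde_ge0.
have G123 p : (0 <= L2density X1 p + L2density X2 p + L2density X3 p)%E.
  by rewrite adde_ge0.
rewrite -(integral3D P mu mu (M _ m1) (M _ m2) (G X1) (G X2)).
rewrite -(integral3D P mu mu M12 (M _ m3) G12 (G X3)).
rewrite -(integral3Zl P mu mu M123 G123); last by [].
apply: integral3_le; [exact: M|exact: measurable_funeM|exact: G|move=> p].
rewrite /L2density !patchE; case: ifPn => [|_]; last by rewrite !adde0 mule0.
move=> /set_mem[_ [/= + _]]; rewrite in_itv/= => pI.
rewrite -!EFinD -EFinM lee_fin -!mulrDl mulrA ler_wpM2r ?sin_ge0_pi//.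
Qed.

End L2_sphere.

(** * The norm of a truncated expansion *)

Section harmonic_sums.
Context {R : realType} {d : measure_display} {W : measurableType d}.
Variable P : probability W R.
Implicit Types (a : nat -> int -> W -> R[i]) (C G : nat -> R) (n l : nat).
Local Notation normc := complex.ComplexField.Normc.normc.

Lemma absz_index l (i : 'I_(l.*2.+1)) : (`|((i : nat)%:Z - l%:Z)%R| <= l)%N.
Proof. by case: i => i /= hi; move: hi; rewrite -addnn; lia. Qed.

Lemma complex_measurable_coef a C l m : harmonic_coefficients P a C ->
  (`|m| <= l)%N -> complex_measurable (a l m).
Proof.
move=> [H _ _ _] /H {}H; split.
  have [+ _] := H 1 0; congr (measurable_fun _ _); apply/funext => w.
  by rewrite mul1r mul0r addr0.
have [+ _] := H 0 1; congr (measurable_fun _ _); apply/funext => w.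
by rewrite mul1r mul0r add0r.
Qed.

Lemma complex_measurable_harmonic_sum a C G n : harmonic_coefficients P a C ->
  complex_measurable (fun p : W * (R * R) => harmonic_sum G a n p.2.1 p.2.2 p.1).
Proof.
move=> H; apply: complex_measurable_sum => l.
apply: complex_measurableM; first exact: complex_measurable_cst.
apply: complex_measurable_sum => i; apply: complex_measurableM.
  apply: (@complex_measurable_comp _ _ _ _ _ _ fst); first exact: measurable_fst.
  exact: (complex_measurable_coef H (absz_index i)).
exact: (complex_measurable_comp measurable_snd (complex_measurable_sph_harm l _)).
Qed.

Lemma spectrum_ge0 a C l : harmonic_coefficients P a C -> 0 <= C l.
Proof.
move=> [_ _ _ H]; have [//|//|+ _] := H l 0 l 0.
rewrite !eqxx/= => E; rewrite -lee_fin -E; apply: expectation_ge0 => w.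
by rewrite ReM Re_conj Im_conj mulrN opprK -!expr2 addr_ge0 ?sqr_ge0.
Qed.

Lemma harmonic_sumB a G G' n t f w :
  harmonic_sum G' a n t f w - harmonic_sum G a n t f w =
  harmonic_sum (fun l => G' l - G l) a n t f w.
Proof.
rewrite /harmonic_sum -sumrB; apply: eq_bigr => l _.
by rewrite -mulrBl; congr (_ * _); apply/eqP; rewrite eq_complex /= subrr !eqxx.
Qed.

Definition energy_poly C G n : {poly R} :=
  \sum_(l < n) \sum_(i < l.*2.+1)
    (G l ^+ 2 * C l) *: legendre_sqr_poly l `|((i : nat)%:Z - l%:Z)%R|%N.

Lemma expectation_sqnorm_harmonic_sum a C G n t f : harmonic_coefficients P a C ->
  (\int[P]_w (sqnorm (harmonic_sum G a n t f w))%:E =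
   ((energy_poly C G n).[cos t])%:E)%E.
Proof.
move=> H.
(* Degree and order are gathered into one finite index, so that the double sum becomes a single
   uncorrelated family. *)
pose I := {l : 'I_n & 'I_(l.*2.+1)}.
pose m (p : I) : int := (tagged p : nat)%:Z - (tag p : nat)%:Z.
pose z (p : I) : R[i] := (G (tag p))%:C%C * sph_harm (tag p) (m p) t f.
pose b (p : I) w := a (tag p) (m p) w.
have mp p : (`|m p| <= tag p)%N by exact: absz_index.
have SE w : harmonic_sum G a n t f w = \sum_(p : I) z p * b p w.
  rewrite /harmonic_sum; under eq_bigr do rewrite mulr_sumr.
  rewrite (sig_big_dep _ _ (fun (l : 'I_n) (i : 'I_(l.*2.+1)) => (G l)%:C%C *
    (a l ((i : nat)%:Z - l%:Z) w * sph_harm l ((i : nat)%:Z - l%:Z) t f))).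
  by apply: eq_bigr => p _; rewrite /z /b /m mulrA mulrAC.
under eq_integral do rewrite SE.
rewrite (uncorrelated_sqnorm (C := fun p : I => C (tag p))).
- congr (_%:E); rewrite /energy_poly.
  rewrite horner_sum; under [in RHS]eq_bigr do rewrite horner_sum.
  rewrite (sig_big_dep _ _ (fun (l : 'I_n) (i : 'I_(l.*2.+1)) =>
    ((G l ^+ 2 * C l) *: legendre_sqr_poly l `|((i : nat)%:Z - l%:Z)%R|%N).[cos t])).
  apply: eq_bigr => p _; rewrite hornerZ /z sqnormM sqnorm_real sqnorm_sph_harm.
  by rewrite mulrAC.
- by move=> p; have [] := complex_measurable_coef H (mp p).
- by move=> p; have [] := complex_measurable_coef H (mp p).
move=> p q; have [_ _ _ {}H] := H; have := H _ _ _ _ (mp p) (mp q).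
congr (complex_expectation _ _ _); congr (if _ then _ else _).
apply/idP/idP => [/andP[/eqP e1 /eqP e2]|/eqP ->]; last by rewrite !eqxx.
move: e1 e2; rewrite /m; case: p {mp} => l i; case: q => l' i' /= e1.
have {}e1 : l = l' by exact: val_inj.
rewrite -{}e1 in i' * => /addIr [] e2.
by apply/eqP; congr (Tagged _ _); exact: val_inj.
Qed.

Lemma sqr_measurable_harmonic_sum a C G n : harmonic_coefficients P a C ->
  sqr_measurable (fun t f w => normc (harmonic_sum G a n t f w)).
Proof.
move=> H; rewrite /sqr_measurable; under eq_fun do rewrite sqnorm_normc.
apply: measurable_funTS; apply: complex_measurable_sqnorm.
exact: (complex_measurable_harmonic_sum _ _ H).
Qed.

(** Parseval's identity: the expectation at a fixed point is a polynomial in [cos t], the longitude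
    contributes [2 pi], and each of the [2l+1] harmonics of degree [l] integrates to 1. *)
Lemma L2sq_harmonic_sum a C G n : harmonic_coefficients P a C ->
  L2sq P (fun t f w => normc (harmonic_sum G a n t f w)) =
  (\sum_(l < n) G l ^+ 2 * C l * (l.*2.+1)%:R)%:E.
Proof.
move=> H; rewrite L2sqE integral3_swap; last 2 first.
- exact: measurable_L2density (sqr_measurable_harmonic_sum _ _ H).
- exact: L2density_ge0.
set Q := energy_poly C G n.
transitivity (\int[lebesgue_measure]_(t in `[0%R, pi%R])
  ((((2 * pi) *: Q).[cos t] * sin t)%R)%:E)%E.
  rewrite [RHS]integral_mkcond; apply: eq_integral => t _; rewrite patchE.
  have E f : (\int[P]_w L2density (fun t f w => normc (harmonic_sum G a n t f w)) (w, (t, f)) =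
      if (t \in `[0%R, pi%R]) && (f \in `[0%R, (2 * pi)%R]) then (Q.[cos t] * sin t)%:E else 0)%E.
    case: ifPn => [/andP[tI fI]|tf].
      transitivity (\int[P]_w ((sin t)%:E * (sqnorm (harmonic_sum G a n t f w))%:E))%E.
        apply: eq_integral => w _; rewrite /L2density patchE ifT; last first.
          by apply/mem_set; split => //; split.
        by rewrite /= sqnorm_normc mulrC EFinM.
      rewrite ge0_integralZl//.
      - by rewrite (expectation_sqnorm_harmonic_sum G n t f H) -EFinM mulrC.
      - apply/measurable_EFinP.
        have mp : measurable_fun setT (fun w : W => (w, (t, f))) by exact: measurable_fun_pair.
        have M := complex_measurable_comp mp (complex_measurable_harmonic_sum G n H).
        exact: (complex_measurable_sqnorm M).
      - by move=> w _; rewrite lee_fin addr_ge0 ?sqr_ge0.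
      - by rewrite lee_fin sin_ge0_pi//; move: tI; rewrite in_itv.
    rewrite integral0_eq// => w _; rewrite /L2density patchE ifN//.
    by apply: contra tf => /set_mem[_ [/= -> ->]].
  under eq_integral do rewrite E.
  case: ifPn => tI; last first.
    rewrite integral0_eq// => f _; rewrite ifF//; apply/negbTE.
    by apply: contra tI => /andP[? _]; exact/mem_set.
  transitivity (\int[lebesgue_measure]_(f in `[0%R, (2 * pi)%R]) (cst (Q.[cos t] * sin t)%:E f))%E.
    rewrite [RHS]integral_mkcond; apply: eq_integral => f _; rewrite patchE.
    have -> : t \in `[0%R, pi%R] by exact: set_mem tI.
    by congr (if _ then _ else _); apply/idP/idP => [?|/set_mem//]; exact/mem_set.
  have p2 : 0 < 2 * pi :> R by rewrite mulr_gt0 ?pi_gt0.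
  have E2 : lebesgue_measure (`[0, 2 * pi]%classic : set R) = (2 * pi)%:E.
    by rewrite lebesgue_measure_itv /= lte_fin p2 -EFinD subr0.
  rewrite integral_cst//; transitivity ((Q.[cos t] * sin t)%:E * (2 * pi)%:E)%E.
    by congr (_ * _)%E; exact: E2.
  by rewrite -EFinM hornerZ; congr (_%:E); ring.
rewrite integral_horner_cos polyintZ; congr (_%:E).
have sumE (I : Type) (s : seq I) (F : I -> {poly R}) :
    polyint (\sum_(i <- s) F i) = \sum_(i <- s) polyint (F i).
  apply: (big_morph _ (@polyintD R)).
  by have := polyintZ 0 (0 : {poly R}); rewrite scale0r mul0r.
rewrite /Q /energy_poly sumE mulr_sumr; apply: eq_bigr => l _.
rewrite sumE mulr_sumr (eq_bigr (fun=> G l ^+ 2 * C l)) ?sumr_const ?card_ord ?mulr_natr// => i _.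
rewrite polyintZ polyint_legendre_sqr_poly ?absz_index//.
have : 2 * pi != 0 :> R by rewrite mulf_neq0 ?pnatr_eq0// gt_eqF// pi_gt0.
by move: (2 * pi) => p p0; field.
Qed.

End harmonic_sums.

(** * From truncated expansions to the field *)

Section L2_limits.
Context {R : realType} {d : measure_display} {W : measurableType d}.
Variable P : probability W R.
Implicit Types (X : R -> R -> W -> R).
Local Notation normc := complex.ComplexField.Normc.normc.

Lemma L2sq_ge0 X : (0 <= L2sq P X)%E.
Proof.
rewrite L2sqE; apply: integral_ge0 => w _; apply: integral_ge0 => t _.
by apply: integral_ge0 => f _; exact: L2density_ge0.
Qed.

Lemma L2norm_le X (k : R) : 0 <= k -> (L2sq P X <= (k ^+ 2)%:E)%E ->
  (L2norm P X <= k%:E)%E.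
Proof.
move=> k0 H; rewrite L2normE.
apply: (@le_trans _ _ (poweR (k ^+ 2)%:E 2^-1)).
  apply: gt0_ler_poweR; rewrite ?in_itv/= ?leey ?L2sq_ge0 ?invr_ge0//.
  by rewrite lee_fin sqr_ge0.
by rewrite poweR_EFin powR12_sqrt ?sqr_ge0// sqrtr_sqr ger0_norm.
Qed.

Lemma L2sq_lt X (k : R) : 0 <= k -> (L2norm P X < k%:E)%E ->
  (L2sq P X <= (k ^+ 2)%:E)%E.
Proof.
move=> k0; apply: contraTT; rewrite -ltNge -leNgt => /ltW H.
rewrite L2normE; apply: (@le_trans _ _ (poweR (k ^+ 2)%:E 2^-1)).
  by rewrite poweR_EFin powR12_sqrt ?sqr_ge0// sqrtr_sqr ger0_norm.
apply: gt0_ler_poweR; rewrite ?in_itv/= ?leey ?L2sq_ge0 ?invr_ge0//.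
by rewrite lee_fin sqr_ge0.
Qed.

Lemma L2sq_cvg0 (X : nat -> R -> R -> W -> R) (e : R) : 0 < e ->
  L2norm P (X n) @[n --> \oo] --> 0%E ->
  \forall n \near \oo, (L2sq P (X n) <= e%:E)%E.
Proof.
move=> e0 H; have s0 : 0 < Num.sqrt e by rewrite sqrtr_gt0.
have : \forall n \near \oo, (L2norm P (X n) < (Num.sqrt e)%:E)%E.
  by apply: (H [set x | (x < (Num.sqrt e)%:E)%E]); apply: open_ereal_lt'; rewrite lte_fin.
by apply: filterS => n /(L2sq_lt (ltW s0)); rewrite sqr_sqrtr// ltW.
Qed.

Lemma sqr_measurable_normc_sub X a C G n : harmonic_coefficients P a C ->
  jointly_measurable X ->
  sqr_measurable (fun t f w => normc ((X t f w)%:C%C - harmonic_sum G a n t f w)).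
Proof.
move=> H mX; have [mR mI] := complex_measurable_harmonic_sum G n H.
rewrite /sqr_measurable.
rewrite (_ : (fun _ => _) = fun p : W * (R * R) =>
  (X p.2.1 p.2.2 p.1 - complex.Re (harmonic_sum G a n p.2.1 p.2.2 p.1)) ^+ 2 +
  complex.Im (harmonic_sum G a n p.2.1 p.2.2 p.1) ^+ 2); last first.
  apply/funext => p; rewrite sqnorm_normc /sqnorm.
  by case: (harmonic_sum _ _ _ _ _ _) => x y /=; rewrite sub0r sqrrN.
apply: measurable_funD; apply: measurable_funX; last exact: measurable_funTS.
by apply: measurable_funB => //; exact: measurable_funTS.
Qed.

Lemma sqr_real_le_sqnorm (z : R[i]) : complex.Re z ^+ 2 <= sqnorm z.
Proof. by rewrite lerDl sqr_ge0. Qed.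

(** The increment is split through the truncated sums as [(X' - S') + (S' - S) + (S - X)], and
    [(p+q+s)^2 <= 3 (p^2+q^2+s^2)] plays the role of the triangle inequality, at the price of the
    factor 3. *)
Lemma L2sq_expansion_sub a C G G' X X' (B : R) : harmonic_coefficients P a C ->
  L2_expansion P G a X -> L2_expansion P G' a X' ->
  (forall n, \sum_(l < n) (G' l - G l) ^+ 2 * C l * (l.*2.+1)%:R <= B) ->
  (L2sq P (fun t f w => (X' t f w - X t f w)%R) <= (3 * B)%:E)%E.
Proof.
move=> H [mX cX] [mX' cX'] HB.
(* Two truncation errors of at most [e / 6] each add up to [e] after the factor 3. *)
apply/lee_addgt0Pr => e e0; have e6 : 0 < e / 6 by rewrite divr_gt0.
have [n _ /(_ n (leqnn n))[A A']] :
    \forall n \near \oo,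
      (L2sq P (fun t f w => normc ((X t f w)%:C%C - harmonic_sum G a n t f w)%R) <= (e / 6)%:E)%E /\
      (L2sq P (fun t f w => normc ((X' t f w)%:C%C - harmonic_sum G' a n t f w)%R) <= (e / 6)%:E)%E.
  by apply: filterI; [exact: (L2sq_cvg0 e6 cX)|exact: (L2sq_cvg0 e6 cX')].
have M : sqr_measurable (fun t f w => X' t f w - X t f w).
  by apply: measurable_funX; exact: measurable_funB.
have := L2sq_le3 P M (sqr_measurable_normc_sub G' n H mX')
  (sqr_measurable_harmonic_sum (fun l => G' l - G l) n H) (sqr_measurable_normc_sub G n H mX).
move=> /(_ _) /le_trans; apply.
  move=> t f w; rewrite !sqnorm_normc -harmonic_sumB.
  set z := harmonic_sum G a n t f w; set z' := harmonic_sum G' a n t f w.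
  (* The field is real and the truncated sums are complex: real parts are compared, each bounded by
     the modulus. *)
  have := sqr_real_le_sqnorm ((X' t f w)%:C%C - z').
  have := sqr_real_le_sqnorm (z' - z).
  have := sqr_real_le_sqnorm ((X t f w)%:C%C - z).
  move: (sqnorm _) (sqnorm _) (sqnorm _) => p q s.
  case: z => x y; case: z' => x' y' /=; move: (X t f w) (X' t f w) => v v' h1 h2 h3.
  have := sqr_ge0 (v' - x' - (x' - x)); have := sqr_ge0 (v' - x' + (v - x)).
  have := sqr_ge0 (x' - x + (v - x)).
  nra.
rewrite (L2sq_harmonic_sum _ _ H).
apply: (@le_trans _ _ (3%:E * ((e / 6)%:E + B%:E + (e / 6)%:E))%E).
  apply: lee_wpmul2l; first by rewrite lee_fin.
  apply: leeD; last exact: A.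
  by apply: leeD; [exact: A'|rewrite lee_fin; exact: HB].
rewrite -!EFinD -EFinM lee_fin.
by have -> : 3 * (e / 6 + B + e / 6) = 3 * B + e by field.
Qed.

End L2_limits.

(** For [n >= 1], [n + 1 <= 2n] and [2n + 1 <= 3n]; at 0 both sides vanish. This is how the weight
    [l (l+1) (2l+1)] is absorbed into [l^3]. *)
Lemma leq_pronic_doubleS n : (n * n.+1 * n.*2.+1 <= 6 * n ^ 3)%N.
Proof.
case: n => [//|n]; have -> : (6 * n.+1 ^ 3 = n.+1 * (2 * n.+1) * (3 * n.+1))%N.
  by rewrite !expnS expn0 muln1 -[6%N]/(2 * 3)%N; ring.
by apply: leq_mul; [apply: leq_mul => //; lia|lia].
Qed.

Theorem theorem4 (R : realType) (d : measure_display) (W : measurableType d)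
    (P : probability W R) (c D r eta_inf : R)
    (T : 'rV[R]_3 -> W -> R) (a : nat -> int -> W -> R[i]) (C : nat -> R)
    (u : R -> R -> R -> W -> R) :
  0 < c -> 0 < D -> 0 < r -> 0 < eta_inf ->
  initial_field P T a C ->
  standing_assumptions P T C ->
  ivp_solution P c D r eta_inf a u ->
  (\sum_(1 <= l <oo) (C l * l%:R ^+ 3)%:E < +oo)%E ->
  exists K : R, forall eta h : R,
    0 <= eta < eta_inf -> 0 < h < eta_inf - eta ->
    (L2norm P (fun t f w => (u (eta + h) t f w - u eta t f w)%R)
       <= (K * h)%:E)%E.
Proof.
move=> c0 D0 r0 e0 [_ _ _ H _] _ sol S_lty.
have C0 l : 0 <= C l by exact: (spectrum_ge0 l H).
set S := (\sum_(1 <= l <oo) _)%E in S_lty.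
have term_ge0 l : (0 <= (C l * l%:R ^+ 3)%:E)%E by rewrite lee_fin mulr_ge0// exprn_ge0.
have S0 : (0 <= S)%E by exact: nneseries_ge0.
have S_fin : S \is a fin_num by rewrite ge0_fin_numE.
(* The hypothesis sums from 1 while the expansions start at 0; the additional term is 0 because
   [0^3 = 0]. *)
have partial n : \sum_(l < n) C l * l%:R ^+ 3 <= fine S.
  case: n => [|n]; first by rewrite big_ord0 fine_ge0.
  rewrite -lee_fin fineK// -(big_mkord xpredT (fun l => C l * l%:R ^+ 3)).
  rewrite big_ltn// expr0n mulr0 add0r -sumEFin.
  exact: nneseries_lim_ge.
have [K HK] := F_mode_lipschitz c0 D0 r0 e0.
(* Here [18 = 3 * 6], with 3 from the splitting in [L2sq_expansion_sub] and 6 from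
   [leq_pronic_doubleS]; the absolute value covers a constant [K] of unspecified sign. *)
pose B : R := 18 * `|K| * fine S.
have B0 : 0 <= B by rewrite !mulr_ge0// fine_ge0.
exists (Num.sqrt B) => eta h etaI hI.
have h0 : 0 < h by have /andP[] := hI.
apply: L2norm_le; first by rewrite mulr_ge0 ?sqrtr_ge0 ?ltW.
rewrite exprMn sqr_sqrtr//.
have etahI : 0 <= eta + h < eta_inf.
  by move: etaI hI => /andP[? ?] /andP[? ?]; apply/andP; split; lra.
have -> : B * h ^+ 2 = 3 * (6 * `|K| * h ^+ 2 * fine S) by rewrite /B; ring.
apply: (L2sq_expansion_sub H (sol _ etaI) (sol _ etahI)) => n.
have h2 : 0 <= h ^+ 2 := sqr_ge0 h.
have w0 : 0 <= 6 * `|K| * h ^+ 2 by apply: mulr_ge0 => //; exact: mulr_ge0.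
apply: le_trans (ler_wpM2l w0 (partial n)).
rewrite mulr_sumr; apply: ler_sum => l _.
have nat_le : (l * l.+1)%:R * (l.*2.+1)%:R <= 6 * l%:R ^+ 3 :> R.
  have := leq_pronic_doubleS l.
  by rewrite -(ler_nat R) (natrM _ (_ * _)%N) (natrM _ 6) natrX.
have HF : (F_mode c D r eta_inf l (eta + h) - F_mode c D r eta_inf l eta) ^+ 2 <=
    `|K| * h ^+ 2 * (l * l.+1)%:R.
  apply: le_trans (HK l eta h etaI hI) _.
  by rewrite mulrAC ler_wpM2r// ler_wpM2r ?sqr_ge0// ler_norm.
apply: (@le_trans _ _ (`|K| * h ^+ 2 * (l * l.+1)%:R * C l * (l.*2.+1)%:R)).
  by rewrite ler_wpM2r// ler_wpM2r.
rewrite (_ : _ * (l.*2.+1)%:R = `|K| * h ^+ 2 * C l * ((l * l.+1)%:R * (l.*2.+1)%:R)); last by ring.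
rewrite (_ : 6 * _ * _ * _ = `|K| * h ^+ 2 * C l * (6 * l%:R ^+ 3)); last by ring.
by apply: ler_wpM2l => //; apply: mulr_ge0 => //; exact: mulr_ge0.
Qed.
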